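(* Let $E_1,\ldots,E_m,F$ be (real) Banach lattices with $F$ $\sigma$-Dedekind complete and containing a copy of $\ell_\infty$. The following are equivalent. (a) Every continuous $m$-linear operator $A\colon E_1\times\cdots\times E_m\longrightarrow F$ admits an almost Dunford-Pettis Aron-Berner extension (that is, $AB_m^\rho(A)$ is almost Dunford-Pettis for some $\rho\in S_m$). (b) Every regular $m$-linear operator $A\colon E_1\times\cdots\times E_m\longrightarrow F$ admits an almost Dunford-Pettis Aron-Berner extension. (c) Every positive $m$-linear operator $A\colon E_1\times\cdots\times E_m\longrightarrow F$ admits an almost Dunford-Pettis Aron-Berner extension. (d) $E_j^{**}$ has the positive Schur property for some $j\in\{1,\ldots,m\}$.
   Context: A sequence $(x_n)$ in a Banach lattice is disjoint if $|x_n|\wedge|x_k|=0$ for $n\ne k$. A Banach lattice $E$ has the positive Schur property if positive weakly null sequences in $E$ are norm null (equivalently, disjoint weakly null sequences, or disjoint positive weakly null sequences, are norm null). A Banach lattice contains a copy of $\ell_\infty$ if it has a closed subspace isomorphic to $\ell_\infty$. An $m$-linear operator between Banach lattices is positive if it maps tuples of positive elements to positive elements, and regular if it is a difference of two positive $m$-linear operators (such operators are continuous). For Banach lattices $E_1,\ldots,E_m$ and a Banach space $G$, an $m$-linear operator $A\colon E_1\times\cdots\times E_m\to G$ is almost Dunford-Pettis if $(A(x_{1,n},\ldots,x_{m,n}))_{n=1}^\infty$ is norm null in $G$ whenever $(x_{j,n})_{n=1}^\infty$ is a disjoint weakly null sequence in $E_j$, $j=1,\ldots,m$. Aron-Berner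 extensions: let $E_1,\ldots,E_m,F$ be real Banach spaces and $\rho\in S_m$ a permutation of $\{1,\ldots,m\}$. For $k=0,\ldots,m$ let $\mathcal{L}_k^\rho$ be the space of continuous $(m-k)$-linear real forms in the variables $x_i\in E_i$, $i\notin\{\rho(1),\ldots,\rho(k)\}$, kept in increasing order of index (so $\mathcal{L}_0^\rho=\mathcal{L}(E_1,\ldots,E_m)$ and $\mathcal{L}_m^\rho=\mathbb{R}$). For $x^{**}_{\rho(k)}\in E_{\rho(k)}^{**}$, the linear operator $\overline{x^{**}_{\rho(k)}}^{\rho}\colon\mathcal{L}_{k-1}^\rho\to\mathcal{L}_k^\rho$ is defined as follows: the value of $\overline{x^{**}_{\rho(k)}}^{\rho}(B)$ at $(x_i)_{i\notin\{\rho(1),\ldots,\rho(k)\}}$ is $x^{**}_{\rho(k)}$ applied to the functional on $E_{\rho(k)}$ obtained from $B$ by fixing these $x_i$ and leaving the $\rho(k)$-th variable free. For a continuous $m$-linear $A\colon E_1\times\cdots\times E_m\to F$, the Aron-Berner extension $AB_m^\rho(A)\colon E_1^{**}\times\cdots\times E_m^{**}\to F^{**}$ is $$AB_m^\rho(A)(x_1^{**},\ldots,x_m^{**})(y^* )=\big(\overline{x^{**}_{\rho(m)}}^{\rho}\circ\cdots\circ\overline{x^{**}_{\rho(1)}}^{\rho}\big)(y^*\circ A),\quad y^*\in F^*.$$ The Aron-Berner extensions of $A$ are the operators $AB_m^\rho(A)$, $\rho\in S_m$. *)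

(* Defs.v *)
From HB Require Import structures.
From mathcomp Require Import all_boot all_order all_algebra all_fingroup.
From mathcomp Require Import boolp classical_sets functions cardinality reals.
From mathcomp Require Import topology normedtype.
From mathcomp Require Import lra.

Set Implicit Arguments.
Unset Strict Implicit.
Unset Printing Implicit Defensive.

Import Order.TTheory GRing.Theory Num.Theory.
Import numFieldNormedType.Exports.

Local Open Scope classical_set_scope.
Local Open Scope ring_scope.

(* The order is carried by the fields below rather than by Order.Lattice:     *)
(* Num.RealDomain already joins Order.Lattice with the additive hierarchy, and *)
(* HB rejects a second such join. vsup x (- x) is the modulus of x.            *)
HB.mixin Record CompleteNormedModule_isBanachLattice (R : realType) E
    & CompleteNormedModule R E := {
  vle : E -> E -> Prop ;
  vsup : E -> E -> E ;
  vinf : E -> E -> E ;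
  vle_refl : forall x, vle x x ;
  vle_anti : forall x y, vle x y -> vle y x -> x = y ;
  vle_trans : forall y x z, vle x y -> vle y z -> vle x z ;
  vle_supP : forall x y z, vle (vsup x y) z <-> vle x z /\ vle y z ;
  vle_infP : forall x y z, vle z (vinf x y) <-> vle z x /\ vle z y ;
  vle_add2r : forall z x y, vle x y -> vle (x + z) (y + z) ;
  vle_scale_ge0 : forall (a : R) x, 0 <= a -> vle 0 x -> vle 0 (a *: x) ;
  vle_norm : forall x y, vle (vsup x (- x)) (vsup y (- y)) -> `|x| <= `|y|
}.

#[short(type="banachLatticeType")]
HB.structure Definition BanachLattice (R : realType) :=
  {E of CompleteNormedModule R E & CompleteNormedModule_isBanachLattice R E}.

Arguments vle_trans {R s y x z}.
Arguments vle_add2r {R s} z {x y}.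
Arguments vle_scale_ge0 {R s a x}.
Arguments vle_norm {R s x y}.

Notation "x <=v y" := (vle x y) (at level 70, no associativity) : ring_scope.

Section Dual.
Variables (R : realType) (E : normedModType R).

Definition dual_pred : {pred E -> R} :=
  fun f => `[< linear f /\ continuous f >].

(* the topological dual *)
Record dual := Dual { dual_fun :> E -> R ; _ : dual_fun \in dual_pred }.

HB.instance Definition _ := [isSub for dual_fun].
HB.instance Definition _ := [Choice of dual by <:].

Fact dual_submod_closed : submod_closed dual_pred.
Proof.
split; first by apply/asboolP; split; [move=> a x y /=; rewrite /= scaler0 addr0|exact: cst_continuous].
move=> a f g /asboolP[lf cf] /asboolP[lg cg]; apply/asboolP; split.
  move=> b x y; rewrite !fctE /= lf lg !scalerDr !scalerA (mulrC a) -!addrA.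
  by congr (_ + _); rewrite addrCA.
by move=> x; apply: cvgD; [apply: cvgZr; exact: cf|exact: cg].
Qed.
HB.instance Definition _ :=
  GRing.isSubmodClosed.Build _ _ dual_pred dual_submod_closed.
HB.instance Definition _ := [SubChoice_isSubLmodule of dual by <:].

Lemma dualP (f : dual) : linear f /\ continuous f.
Proof. exact/asboolP/(valP f). Qed.

HB.instance Definition _ (f : dual) :=
  GRing.isLinear.Build _ _ _ _ f (dualP f).1.

Lemma dual_continuous (f : dual) : continuous f.
Proof. by have [_] := dualP f. Qed.

Lemma dualDE (f g : dual) x : (f + g) x = f x + g x. Proof. by []. Qed.
Lemma dualNE (f : dual) x : (- f) x = - f x. Proof. by []. Qed.
Lemma dualZE a (f : dual) x : (a *: f) x = a * f x. Proof. by []. Qed.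

(* the operator norm *)
Definition dual_norm (f : dual) : R :=
  sup [set `|f x| | x in [set x | `|x| <= 1]].

Lemma dual_bounded (f : dual) : exists M, forall x, `|f x| <= M * `|x|.
Proof.
have /linear_bounded_continuous/linear_boundedP := @dual_continuous f.
by move=> [M [Mr /(_ (M + 1))]]; rewrite ltrDl ltr01 => /(_ isT) ?; exists (M + 1).
Qed.

Lemma dual_has_sup (f : dual) : has_sup [set `|f x| | x in [set x | `|x| <= 1]].
Proof.
split; first by exists `|f 0|, 0 => //=; rewrite normr0.
have [M Mf] := dual_bounded f; exists `|M| => _ [x /= x1 <-].
apply: le_trans (Mf x) _; apply: le_trans (ler_norm _) _.
by rewrite normrM normr_id ler_piMr.
Qed.

Lemma dual_norm_ge0 f : 0 <= dual_norm f.
Proof.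
apply: le_trans (ub_le_sup (dual_has_sup f).2 _); last by exists 0 => /=; rewrite ?normr0.
exact: normr_ge0.
Qed.

Lemma dual_norm_le (f : dual) x : `|f x| <= dual_norm f * `|x|.
Proof.
have [->|x0] := eqVneq x 0; first by rewrite linear0 !normr0 mulr0.
have nx : 0 < `|x| by rewrite normr_gt0.
rewrite -ler_pdivrMr// -[X in _ / X]gtr0_norm// -normrV ?unitfE ?gt_eqF//.
rewrite mulrC -normrM -[_ * _]/(_ *: _) -linearZ.
apply: (ub_le_sup (dual_has_sup f).2); exists (`|x|^-1 *: x) => //=.
by rewrite normrZ normfV normr_id mulVf// gt_eqF.
Qed.

Lemma dual_norm_ub (f : dual) M :
  0 <= M -> (forall x, `|f x| <= M * `|x|) -> dual_norm f <= M.
Proof.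
move=> M0 fM; apply: ge_sup; first exact: (dual_has_sup f).1.
by move=> _ [x /= x1 <-]; apply: le_trans (fM x) _; rewrite ler_piMr.
Qed.

Fact dual_normD f g : dual_norm (f + g) <= dual_norm f + dual_norm g.
Proof.
apply: dual_norm_ub => [|x]; first by rewrite addr_ge0 ?dual_norm_ge0.
by rewrite dualDE mulrDl (le_trans (ler_normD _ _))// lerD ?dual_norm_le.
Qed.

Fact dual_normZ (a : R) f : dual_norm (a *: f) = `|a| * dual_norm f.
Proof.
have H b g : dual_norm (b *: g) <= `|b| * dual_norm g.
  apply: dual_norm_ub => [|x]; first by rewrite mulr_ge0 ?dual_norm_ge0.
  by rewrite dualZE normrM -mulrA ler_wpM2l ?dual_norm_le.
apply/eqP; rewrite eq_le H/=; have [->|a0] := eqVneq a 0.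
  by rewrite normr0 mul0r dual_norm_ge0.
rewrite mulrC -ler_pdivlMr ?normr_gt0// mulrC -normfV.
by rewrite -[X in dual_norm X <= _](@scalerK _ _ a _ f) ?H// unitfE.
Qed.

Fact dual_norm0_eq0 f : dual_norm f = 0 -> f = 0.
Proof.
move=> f0; apply/val_inj/funext => x /=; apply/eqP; rewrite -normr_le0.
by rewrite (le_trans (dual_norm_le f x))// f0 mul0r.
Qed.

HB.instance Definition _ :=
  Lmodule_isNormed.Build R dual dual_normD dual_normZ dual_norm0_eq0.

Lemma dual_ler (f : dual) x : `|f x| <= `|f| * `|x|.
Proof. exact: dual_norm_le. Qed.

Lemma dual_pred_bounded (f : E -> R) M :
  linear f -> (forall x, `|f x| <= M * `|x|) -> f \in dual_pred.
Proof.
move=> lf fM; apply/asboolP; split=> //.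
pose fl : {linear E -> R} := HB.pack f (GRing.isLinear.Build _ _ _ _ _ lf).
have /linear_bounded_continuous : bounded_near fl (nbhs 0); last by [].
apply/linear_boundedP; exists M; split; first exact: num_real.
by move=> N MN x; apply: le_trans (fM x) _; rewrite ler_wpM2r// ltW.
Qed.

Fact dual_complete (F : set_system dual) :
  ProperFilter F -> cauchy F -> cvg F.
Proof.
move=> FF Fc.
have Fe e : 0 < e -> exists f, \forall g \near F, `|f - g| <= e.
  move=> e0; have /cauchyP/(_ e e0)[f Ff] := Fc; exists f.
  by move: Ff; rewrite -ball_normE/=; apply: filterS => g /ltW.
have lx x : exists l : R, (fun f : dual => f x) @ F --> l.
  suff: cvg ((fun f : dual => f x) @ F) by move=> /cvg_ex[l Hl]; exists l.
  apply: R_complete; apply: cauchy_exP => e e0.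
  have x1 : 0 < `|x| + 1 by rewrite ltr_wpDl.
  have [f Ff] := Fe (e / (`|x| + 1)) (divr_gt0 e0 x1).
  exists (f x); apply: filterS Ff => g fg; rewrite -ball_normE /=.
  apply: le_lt_trans (_ : e / (`|x| + 1) * `|x| < e).
    by apply: le_trans (dual_ler (f - g) x) _; rewrite ler_wpM2r.
  by rewrite mulrAC ltr_pdivrMr// ltr_pM2l// ltrDl.
pose l x := projT1 (cid (lx x)).
have lP x : (fun f : dual => f x) @ F --> l x by exact: projT2 (cid (lx x)).
have ll : linear l.
  move=> a x y; suff H : (fun f : dual => f (a *: x + y)) @ F -->
      (a * l x + l y : R) by exact: (cvg_unique _ (lP _) H).
  rewrite (_ : (fun f : dual => _) = (fun f : dual => a * f x + f y)).
    by apply: cvgD; [apply: cvgZr; exact: lP|exact: lP].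
  by apply/funext => f; rewrite linearP.
have le_l f e : (\forall g \near F, `|f - g| <= e) ->
    forall x, `|f x - l x| <= e * `|x|.
  move=> Ff x; apply/ler_addgt0Pr => d d0.
  have /cvgrPdist_le/(_ d d0) lxd := lP x.
  have [g [fg lg]] := filter_ex (filterI Ff lxd).
  rewrite -(subrK (g x) (f x)) -addrA (le_trans (ler_normD _ _))//.
  rewrite lerD//; last by rewrite distrC.
  by apply: le_trans (dual_ler (f - g) x) _; rewrite ler_wpM2r.
have [f0 Ff0] := Fe 1 ltr01.
have lb x : `|l x| <= (`|f0| + 1) * `|x|.
  rewrite -(subrK (f0 x) (l x)) (le_trans (ler_normD _ _))// mulrDl addrC.
  by rewrite lerD ?dual_ler// distrC le_l.
pose L := Dual (dual_pred_bounded ll lb).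
apply/cvg_ex; exists L; apply/cvgrPdist_le => e e0.
have [f Ff] := Fe (e / 2) (divr_gt0 e0 (ltr0n _ 2)).
near=> g; rewrite -(subrK f L) -addrA (le_trans (ler_normD _ _))//.
rewrite (splitr e) lerD//; last by near: g.
rewrite distrC; apply: dual_norm_ub => [|x]; first by rewrite ltW// divr_gt0.
exact: le_l.
Unshelve. all: by end_near. Qed.

HB.instance Definition _ := Uniform_isComplete.Build dual dual_complete.

End Dual.

Section BanachLatticeTheory.
Variables (R : realType) (E : banachLatticeType R).
Implicit Types x y z u v : E.

Definition vabs x := vsup x (- x).

Lemma vle_supl x y : x <=v vsup x y.
Proof. by have [/(_ (vle_refl _))[]] := vle_supP x y (vsup x y). Qed.

Lemma vle_supr x y : y <=v vsup x y.
Proof. by have [/(_ (vle_refl _))[]] := vle_supP x y (vsup x y). Qed.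

Lemma vle_sup x y z : x <=v z -> y <=v z -> vsup x y <=v z.
Proof. by move=> xz yz; apply/vle_supP. Qed.

Lemma vle_infl x y : vinf x y <=v x.
Proof. by have [/(_ (vle_refl _))[]] := vle_infP x y (vinf x y). Qed.

Lemma vle_infr x y : vinf x y <=v y.
Proof. by have [/(_ (vle_refl _))[]] := vle_infP x y (vinf x y). Qed.

Lemma vle_inf x y z : z <=v x -> z <=v y -> z <=v vinf x y.
Proof. by move=> xz yz; apply/vle_infP. Qed.

Lemma vleD x y u v : x <=v y -> u <=v v -> x + u <=v y + v.
Proof.
move=> xy uv; apply: (vle_trans (vle_add2r u xy)).
by rewrite ![y + _]addrC; exact: vle_add2r.
Qed.

Lemma vsubr_ge0 x y : 0 <=v y - x <-> x <=v y.
Proof.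
by split=> [/(vle_add2r x)|/(vle_add2r (- x))]; rewrite ?subrK ?add0r ?subrr.
Qed.

Lemma vleN x y : x <=v y -> - y <=v - x.
Proof.
by move/(vle_add2r (- x - y)); rewrite addrA subrr add0r addrCA subrr addr0.
Qed.

Lemma voppr_le0 x : 0 <=v x -> - x <=v 0.
Proof. by move=> /vleN; rewrite oppr0. Qed.

Lemma vaddr_ge0 x y : 0 <=v x -> 0 <=v y -> 0 <=v x + y.
Proof. by move=> x0 y0; rewrite -[0](addr0 0); exact: vleD. Qed.

Lemma vabs_ge0 x : 0 <=v vabs x.
Proof.
have : 0 <=v vabs x + vabs x.
  by rewrite -[0](subrr x); apply: vleD; [exact: vle_supl|exact: vle_supr].
rewrite -mulr2n -scaler_nat => /(vle_scale_ge0 (_ : 0 <= 2^-1 :> R)).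
by rewrite scalerA mulVf ?scale1r ?pnatr_eq0//; apply; rewrite invr_ge0.
Qed.

Lemma vabs_pos x : 0 <=v x -> vabs x = x.
Proof.
move=> x0; apply: vle_anti; last exact: vle_supl.
apply: vle_sup; first exact: vle_refl.
exact: vle_trans (voppr_le0 x0) x0.
Qed.

Lemma vle_norm_pos x y : vabs x <=v y -> `|x| <= `|y|.
Proof.
by move=> xy; apply: vle_norm; apply: (vle_trans xy); exact: vle_supl.
Qed.

Definition vpos x := vsup x 0.

Lemma vpos_ge0 x : 0 <=v vpos x. Proof. exact: vle_supr. Qed.

Lemma vneg_ge0 x : 0 <=v vpos x - x.
Proof. by apply/vsubr_ge0; exact: vle_supl. Qed.

Lemma norm_vpos x : `|vpos x| <= `|x|.
Proof.
apply: vle_norm; rewrite -/(vabs _) vabs_pos; last exact: vpos_ge0.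
by apply: vle_sup; [exact: vle_supl|exact: vabs_ge0].
Qed.

Lemma norm_vabs2 x : `|vpos x + (vpos x - x)| <= `|x|.
Proof.
apply: vle_norm; rewrite -/(vabs _) -/(vabs _).
apply: vle_sup; last first.
  apply: (@vle_trans _ _ 0); last exact: vabs_ge0.
  by apply: voppr_le0; exact: vaddr_ge0 (vpos_ge0 x) (vneg_ge0 x).
have h : vpos x <=v 2^-1 *: (vabs x + x).
  apply: vle_sup; last first.
    apply: vle_scale_ge0; first by rewrite invr_ge0.
    by rewrite -[0](addNr x); apply: vleD; [exact: vle_supr|exact: vle_refl].
  apply: (@vle_trans _ _ (2^-1 *: (x + x))).
    rewrite scalerDr -scalerDl -[X in (X + X) *: _]div1r -splitr scale1r.
    exact: vle_refl.
  apply/vsubr_ge0; rewrite -scalerBr; apply: vle_scale_ge0.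
    by rewrite invr_ge0.
  by apply/vsubr_ge0; apply: vle_add2r; exact: vle_supl.
have := vleD h h; rewrite -scalerDl -[X in (X + X) *: _]div1r -splitr scale1r.
by move=> /(vle_add2r (- x)); rewrite addrK addrA.
Qed.

(* Riesz decomposition *)
Lemma vriesz x y z : 0 <=v z -> 0 <=v y -> 0 <=v x -> z <=v x + y ->
  exists u v, [/\ z = u + v, 0 <=v u /\ u <=v x & 0 <=v v /\ v <=v y].
Proof.
move=> z0 y0 x0 zxy; exists (vinf z x), (z - vinf z x); split.
- by rewrite addrC subrK.
- by split; [exact: vle_inf|exact: vle_infr].
- split; first by apply/vsubr_ge0; exact: vle_infl.
  apply/vsubr_ge0; rewrite opprB addrCA -opprB; apply/vsubr_ge0.
  apply: vle_inf; last by move/(vle_add2r (- y)): zxy; rewrite addrK.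
  by rewrite -[X in _ <=v X]addr0; apply: vleD; [exact: vle_refl|exact: voppr_le0].
Qed.

End BanachLatticeTheory.

Section DualLattice.
Variables (R : realType) (E : banachLatticeType R).
Implicit Types (f g h : dual E) (x y u v : E).

Definition dle f g := forall x, 0 <=v x -> f x <= g x.

(* f^+ on the positive cone; dpos_fun extends it through the decomposition     *)
(* x = x^+ - (x^+ - x).                                                        *)
Definition dposc f x : R := sup [set f y | y in [set y | 0 <=v y /\ y <=v x]].

Lemma dposc_has_sup f x : 0 <=v x ->
  has_sup [set f y | y in [set y | 0 <=v y /\ y <=v x]].
Proof.
move=> x0; split; first by exists (f 0), 0 => //=; split=> //; exact: vle_refl.
exists (`|f| * `|x|) => _ [y [y0 yx] <-].
apply: le_trans (ler_norm _) _; apply: le_trans (dual_ler f y) _.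
by rewrite ler_wpM2l//; apply: vle_norm_pos; rewrite vabs_pos.
Qed.

Lemma dposc_ub f x y : 0 <=v y -> y <=v x -> f y <= dposc f x.
Proof.
move=> y0 yx; apply: ub_le_sup; last by exists y.
by have [] := dposc_has_sup f (vle_trans y0 yx).
Qed.

Lemma dposc_le f x M : 0 <=v x ->
  (forall y, 0 <=v y -> y <=v x -> f y <= M) -> dposc f x <= M.
Proof.
move=> x0 fM; apply: ge_sup; first by have [] := dposc_has_sup f x0.
by move=> _ [y [y0 yx] <-]; exact: fM.
Qed.

Lemma dposc_bound f x : 0 <=v x -> `|dposc f x| <= `|f| * `|x|.
Proof.
move=> x0; rewrite ger0_norm; last first.
  by rewrite -(linear0 f); apply: dposc_ub => //; exact: vle_refl.
apply: dposc_le => // y y0 yx.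
apply: le_trans (ler_norm _) _; apply: le_trans (dual_ler f y) _.
by rewrite ler_wpM2l//; apply: vle_norm_pos; rewrite vabs_pos.
Qed.

Lemma dposcD f x y : 0 <=v x -> 0 <=v y ->
  dposc f (x + y) = dposc f x + dposc f y.
Proof.
move=> x0 y0; apply/eqP; rewrite eq_le; apply/andP; split.
  apply: dposc_le; first exact: vaddr_ge0.
  move=> z z0 /(vriesz z0 y0 x0)[u [v [-> [u0 ux] [v0 vy]]]].
  by rewrite linearD lerD ?dposc_ub.
rewrite -lerBrDr; apply: dposc_le => // u u0 ux; rewrite lerBrDl -lerBrDr.
apply: dposc_le => // v v0 vy; rewrite lerBrDl -linearD addrC.
by apply: dposc_ub; [exact: vaddr_ge0|rewrite addrC; exact: vleD].
Qed.

Lemma dposcZ f a x : 0 < a -> 0 <=v x -> dposc f (a *: x) = a * dposc f x.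
Proof.
have H b y : 0 < b -> 0 <=v y -> dposc f (b *: y) <= b * dposc f y.
  move=> b0 y0; apply: dposc_le; first exact: vle_scale_ge0 (ltW b0) y0.
  move=> z z0 zy; rewrite mulrC -ler_pdivrMr// mulrC -[_ * _]/(_ *: _).
  rewrite -linearZ; apply: dposc_ub.
    by apply: vle_scale_ge0 => //; rewrite invr_ge0 ltW.
  apply/vsubr_ge0; rewrite -[y](@scalerK _ _ b) ?unitfE ?gt_eqF//.
  rewrite -scalerBr; apply: vle_scale_ge0; first by rewrite invr_ge0 ltW.
  exact/vsubr_ge0.
move=> a0 x0; apply/eqP; rewrite eq_le H//= mulrC -ler_pdivlMr// mulrC.
rewrite -[X in dposc f X <= _](@scalerK _ _ a) ?unitfE ?gt_eqF//.
by apply: H; rewrite ?invr_gt0//; exact: vle_scale_ge0 (ltW a0) x0.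
Qed.

Definition dpos_fun f x := dposc f (vpos x) - dposc f (vpos x - x).

Lemma dpos_funE f u v : 0 <=v u -> 0 <=v v ->
  dpos_fun f (u - v) = dposc f u - dposc f v.
Proof.
move=> u0 v0; rewrite /dpos_fun; have := vpos_ge0 (u - v).
have := vneg_ge0 (u - v); set w := vpos _ => wn wp.
have /(congr1 (dposc f)) : w + v = u + (w - (u - v)).
  by rewrite opprB addrCA [u + _]addrC subrK.
by rewrite (dposcD f wp v0) (dposcD f u0 wn); lra.
Qed.

Lemma dpos_fun_linear f : linear (dpos_fun f).
Proof.
have D x y : dpos_fun f (x + y) = dpos_fun f x + dpos_fun f y.
  have -> : x + y = (vpos x + vpos y) - ((vpos x - x) + (vpos y - y)).
    by rewrite addrACA -opprD opprB addrCA subrr addr0.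
  rewrite dpos_funE; first 1 last.
  - exact: vaddr_ge0 (vpos_ge0 x) (vpos_ge0 y).
  - exact: vaddr_ge0 (vneg_ge0 x) (vneg_ge0 y).
  rewrite (dposcD f (vpos_ge0 x) (vpos_ge0 y)).
  by rewrite (dposcD f (vneg_ge0 x) (vneg_ge0 y)) /dpos_fun; lra.
have F0 : dpos_fun f 0 = 0.
  by apply: (@addrI _ (dpos_fun f 0)); rewrite -D !addr0.
have N x : dpos_fun f (- x) = - dpos_fun f x.
  by apply/eqP; rewrite -addr_eq0 -D addNr F0.
have Z a x : 0 < a -> dpos_fun f (a *: x) = a * dpos_fun f x.
  move=> a0; rewrite -[x in LHS](subKr (vpos x)) scalerBr dpos_funE.
  - by rewrite !dposcZ -?mulrBr//; [exact: vneg_ge0|exact: vpos_ge0].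
  - exact: vle_scale_ge0 (ltW a0) (vpos_ge0 x).
  - exact: vle_scale_ge0 (ltW a0) (vneg_ge0 x).
move=> a x y; rewrite D; congr (_ + _).
have [a0|a0|->] := ltgtP a 0; last by rewrite !scale0r F0.
  by rewrite -[a]opprK scaleNr N Z ?oppr_gt0// scaleNr.
exact: Z.
Qed.

Lemma dpos_fun_bound f x : `|dpos_fun f x| <= (`|f| * 3) * `|x|.
Proof.
apply: le_trans (ler_normB _ _) _.
have -> : `|f| * 3 * `|x| = `|f| * `|x| + `|f| * (`|x| + `|x|) by lra.
apply: lerD; first apply: le_trans (dposc_bound f (vpos_ge0 x)) _.
  by rewrite ler_wpM2l ?norm_vpos.
apply: le_trans (dposc_bound f (vneg_ge0 x)) _; rewrite ler_wpM2l//.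
by apply: le_trans (ler_normB _ _) _; rewrite lerD2r norm_vpos.
Qed.

Definition dpos f : dual E :=
  Dual (dual_pred_bounded (@dpos_fun_linear f) (dpos_fun_bound f)).

Lemma dposE f x : 0 <=v x -> dpos f x = dposc f x.
Proof.
move=> x0; rewrite /= -[x in LHS]subr0 dpos_funE ?subr0//; last exact: vle_refl.
suff -> : dposc f 0 = 0 by rewrite subr0.
have z0 : 0 <=v (0 : E) by exact: vle_refl.
by apply: (@addrI _ (dposc f 0)); rewrite -dposcD// !addr0.
Qed.

(* Riesz-Kantorovich: f \/ g = g + (f - g)^+ *)
Definition dsup f g := g + dpos (f - g).
Definition dinf f g := - dsup (- f) (- g).

Fact dle_refl f : dle f f. Proof. by []. Qed.

Fact dle_anti f g : dle f g -> dle g f -> f = g.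
Proof.
move=> fg gf; have fgE x : 0 <=v x -> f x = g x.
  by move=> x0; apply/eqP; rewrite eq_le fg ?gf.
apply/val_inj/funext => x /=.
have H h : h x = h (vpos x) - h (vpos x - x) by rewrite -linearB subKr.
by rewrite (H f) (H g) !fgE//; [exact: vneg_ge0|exact: vpos_ge0].
Qed.

Fact dle_trans g f h : dle f g -> dle g h -> dle f h.
Proof. by move=> fg gh x x0; rewrite (le_trans (fg x x0))// gh. Qed.

Lemma dsupE f g x : 0 <=v x -> dsup f g x = g x + dposc (f - g) x.
Proof. by move=> x0; rewrite dualDE dposE. Qed.

Fact dle_supP f g h : dle (dsup f g) h <-> dle f h /\ dle g h.
Proof.
split=> [fgh|[fh gh] x x0].
  split; apply: dle_trans fgh => x x0; rewrite dsupE// -lerBlDl.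
    by rewrite -dualNE -dualDE; apply: dposc_ub => //; exact: vle_refl.
  by rewrite subrr -(linear0 (f - g)); apply: dposc_ub => //; exact: vle_refl.
rewrite dsupE// -lerBrDl; apply: dposc_le => // y y0 yx.
rewrite dualDE dualNE.
have := gh (x - y) (iffRL (vsubr_ge0 _ _) yx); have := fh y y0.
by rewrite !linearB/=; lra.
Qed.

Lemma dleN f g : dle f g -> dle (- g) (- f).
Proof. by move=> fg x x0; rewrite !dualNE lerN2 fg. Qed.

Fact dle_infP f g h : dle h (dinf f g) <-> dle h f /\ dle h g.
Proof.
split=> [/dleN|[/dleN hf /dleN hg]].
  by rewrite opprK => /dle_supP[/dleN + /dleN]; rewrite !opprK.
by rewrite -[h]opprK; apply: dleN; apply/dle_supP.
Qed.

Fact dle_add2r h f g : dle f g -> dle (f + h) (g + h).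
Proof. by move=> fg x x0; rewrite !dualDE lerD2r fg. Qed.

Fact dle_scale_ge0 (a : R) f : 0 <= a -> dle 0 f -> dle 0 (a *: f).
Proof. by move=> a0 f0 x x0; rewrite dualZE mulr_ge0// f0. Qed.

Lemma dual_ler_dabs f x :
  `|f x| <= dsup f (- f) (vpos x + (vpos x - x)).
Proof.
have [fs Nfs] := (dle_supP f (- f) _).1 (dle_refl (dsup f (- f))).
move: (dsup f (- f)) fs Nfs => P fs Nfs; rewrite linearD.
have := fs _ (vpos_ge0 x); have := Nfs _ (vpos_ge0 x).
have := fs _ (vneg_ge0 x); have := Nfs _ (vneg_ge0 x).
have -> : f x = f (vpos x) - f (vpos x - x) by rewrite -linearB subKr.
by rewrite !dualNE => *; rewrite ler_norml; lra.
Qed.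

Lemma dabs_le f u : 0 <=v u -> dsup f (- f) u <= `|f| * `|u|.
Proof.
move=> u0; rewrite dsupE// -lerBrDl; apply: dposc_le => // y y0 yu.
have : `|f (y + y - u)| <= `|f| * `|u|.
  apply: le_trans (dual_ler _ _) _; rewrite ler_wpM2l//.
  apply: vle_norm_pos; apply: vle_sup; apply/vsubr_ge0.
    have /vsubr_ge0 h := vleD yu yu.
    by move: h; congr vle; rewrite opprB addrA.
  by rewrite opprK addrC subrK; exact: vaddr_ge0.
rewrite opprK !dualDE !dualNE linearB linearD/= ler_norml => /andP[_].
lra.
Qed.

Fact dle_norm f g : dle (dsup f (- f)) (dsup g (- g)) -> `|f| <= `|g|.
Proof.
move=> fg; apply: dual_norm_ub => // x.
have x0 : 0 <=v vpos x + (vpos x - x).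
  exact: vaddr_ge0 (vpos_ge0 x) (vneg_ge0 x).
apply: le_trans (dual_ler_dabs f x) _; apply: le_trans (fg _ x0) _.
by apply: le_trans (dabs_le g x0) _; rewrite ler_wpM2l ?norm_vabs2.
Qed.

HB.instance Definition _ :=
  CompleteNormedModule_isBanachLattice.Build R (dual E)
    dle_refl dle_anti dle_trans dle_supP dle_infP dle_add2r dle_scale_ge0
    dle_norm.

End DualLattice.

(* The Banach space of bounded real sequences with the supremum norm. *)
Section Linf.
Variable R : realType.

Definition linf_pred : {pred nat -> R} :=
  fun a => `[< exists M, forall n, `|a n| <= M >].

Record linf := Linf { linf_seq :> nat -> R ; _ : linf_seq \in linf_pred }.

HB.instance Definition _ := [isSub for linf_seq].
HB.instance Definition _ := [Choice of linf by <:].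

Fact linf_submod_closed : submod_closed linf_pred.
Proof.
split; first by apply/asboolP; exists 0 => n; rewrite normr0.
move=> c a b /asboolP[M aM] /asboolP[N bN]; apply/asboolP.
exists (`|c| * M + N) => n; apply: le_trans (ler_normD _ _) _.
by rewrite lerD// normrM ler_wpM2l.
Qed.
HB.instance Definition _ :=
  GRing.isSubmodClosed.Build _ _ linf_pred linf_submod_closed.
HB.instance Definition _ := [SubChoice_isSubLmodule of linf by <:].

Definition linf_norm (a : linf) : R := sup (range (fun n => `|a n|)).

Lemma linf_has_sup (a : linf) : has_sup (range (fun n => `|a n|)).
Proof.
split; first by exists `|a 0|, 0.
by have /asboolP[M aM] := valP a; exists M => _ [n _ <-].
Qed.

Lemma linf_norm_ge (a : linf) n : `|a n| <= linf_norm a.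
Proof. by apply: (ub_le_sup (linf_has_sup a).2); exists n. Qed.

Lemma linf_norm_le (a : linf) M : (forall n, `|a n| <= M) -> linf_norm a <= M.
Proof.
by move=> aM; apply: (ge_sup (linf_has_sup a).1) => _ [n _ <-].
Qed.

Fact linf_normD a b : linf_norm (a + b) <= linf_norm a + linf_norm b.
Proof.
apply: linf_norm_le => n.
by rewrite (le_trans (ler_normD (a n) (b n)))// lerD ?linf_norm_ge.
Qed.

Fact linf_normZ (c : R) a : linf_norm (c *: a) = `|c| * linf_norm a.
Proof.
have H d b : linf_norm (d *: b) <= `|d| * linf_norm b.
  apply: linf_norm_le => n; rewrite [X in X <= _](normrM d (b n)).
  by rewrite ler_wpM2l ?linf_norm_ge.
apply/eqP; rewrite eq_le H/=; have [->|c0] := eqVneq c 0.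
  by rewrite normr0 mul0r (le_trans _ (linf_norm_ge _ 0)).
rewrite mulrC -ler_pdivlMr ?normr_gt0// mulrC -normfV.
by rewrite -[X in linf_norm X <= _](@scalerK _ _ c _ a) ?H// unitfE.
Qed.

Fact linf_norm0_eq0 a : linf_norm a = 0 -> a = 0.
Proof.
move=> a0; apply/val_inj/funext => n /=; apply/eqP; rewrite -normr_le0.
by rewrite -a0 linf_norm_ge.
Qed.

HB.instance Definition _ :=
  Lmodule_isNormed.Build R linf linf_normD linf_normZ linf_norm0_eq0.

End Linf.

Section Notions.
Variable R : realType.

(* F has a closed subspace (the range of T) linearly homeomorphic to G *)
Definition contains_copy (G F : normedModType R) :=
  exists (T : {linear G -> F}) (S : F -> G),
    [/\ closed (range T), continuous T, cancel T S
      & {within range T, continuous S}].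

Definition sigma_Dedekind_complete (F : banachLatticeType R) :=
  forall A : set F, countable A -> A !=set0 ->
    (exists b, forall x, A x -> x <=v b) ->
  exists s, (forall x, A x -> x <=v s) /\
    forall b, (forall x, A x -> x <=v b) -> s <=v b.

Definition disjoint_seq (E : banachLatticeType R) (u : nat -> E) :=
  forall n k, n != k -> vinf (vabs (u n)) (vabs (u k)) = 0.

Definition weakly_null (E : normedModType R) (u : nat -> E) :=
  forall f : dual E, f (u n) @[n --> \oo] --> (0 : R).

Definition positive_Schur (E : banachLatticeType R) :=
  forall u : nat -> E, (forall n, 0 <=v u n) -> weakly_null u ->
  u n @[n --> \oo] --> (0 : E).

End Notions.

Section Multilinear.
Variables (R : realType) (m : nat).

Definition multilinear (E : 'I_m -> lmodType R) (F : lmodType R)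
    (A : (forall i, E i) -> F) :=
  forall i (x : forall j, E j), linear (fun t : E i => A (dfwith x t)).

(* joint continuity, for the product topology *)
Definition cts_multilinear (E : 'I_m -> normedModType R) (F : normedModType R)
    (A : (forall i, E i) -> F) :=
  multilinear A /\ continuous (A : prod_topology E -> F).

Definition positive_multilinear (E : 'I_m -> banachLatticeType R)
    (F : banachLatticeType R) (A : (forall i, E i) -> F) :=
  multilinear A /\ forall x, (forall i, 0 <=v x i) -> 0 <=v A x.

Definition regular_multilinear (E : 'I_m -> banachLatticeType R)
    (F : banachLatticeType R) (A : (forall i, E i) -> F) :=
  exists A1 A2, [/\ positive_multilinear A1, positive_multilinear A2
    & forall x, A x = A1 x - A2 x].

Definition almost_DP (E : 'I_m -> banachLatticeType R) (G : normedModType R)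
    (A : (forall i, E i) -> G) :=
  forall x : forall j, nat -> E j,
    (forall j, disjoint_seq (x j) /\ weakly_null (x j)) ->
  A (fun j => x j n) @[n --> \oo] --> (0 : G).

End Multilinear.

Section AronBerner.
Variables (R : realType) (m : nat) (E : 'I_m -> normedModType R).

(* A form in the variables x_j, j in S, is represented by a function on the    *)
(* whole product that ignores the coordinates outside S. ab_step x2 removes    *)
(* the variable i: it applies x2 to the slice of B in that variable, seen as   *)
(* an element of the dual of E i. insubd falls back on 0 only if the slice is  *)
(* not linear and continuous, which does not happen for the forms that arise   *)
(* from a continuous multilinear operator: see ab_stepE, form_on_iter and      *)
(* form_on_comp.                                                               *)
Definition ab_step i (x2 : dual (dual (E i))) (B : (forall j, E j) -> R) :
    (forall j, E j) -> R :=
  fun x => x2 (insubd 0 (fun t : E i => B (dfwith x t))).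

(* x2 (rho 0) acts first, x2 (rho m.-1) last *)
Definition ab_form (rho : 'S_m) (x2 : forall i, dual (dual (E i)))
    (B : (forall j, E j) -> R) : (forall j, E j) -> R :=
  foldl (fun B' k => ab_step (x2 (rho k)) B') B (enum 'I_m).

(* No variable is left after the iteration, so the evaluation point 0 is       *)
(* irrelevant; insubd is again never out of range for a continuous multilinear *)
(* A: see aron_berner_dual and aron_bernerE. Regular operators are continuous, *)
(* so this covers them too.                                                    *)
Definition aron_berner (F : normedModType R) (rho : 'S_m)
    (A : (forall i, E i) -> F) (x2 : forall i, dual (dual (E i))) :
    dual (dual F) :=
  insubd 0 (fun y : dual F => ab_form rho x2 (y \o A) (fun=> 0)).

End AronBerner.

Definition has_almost_DP_AB (R : realType) (m : nat)
    (E : 'I_m -> banachLatticeType R) (F : banachLatticeType R)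
    (A : (forall i, E i) -> F) :=
  exists rho : 'S_m,
    @almost_DP R m (fun i => dual (dual (E i))) (dual (dual F))
      (aron_berner rho A).

Section AronBernerTheory.
Variables (R : realType) (m : nat) (E : 'I_m -> normedModType R).
Implicit Types (B C : (forall j, E j) -> R) (x : forall j, E j).

Lemma dfwithK x i (s t : E i) : dfwith (dfwith x s) t = dfwith x t.
Proof.
apply: functional_extensionality_dep => k.
have [<-|ik] := eqVneq i k; first by rewrite !dfwith_in.
by rewrite !dfwith_out.
Qed.

Lemma dfwithC x i j (t : E i) (s : E j) : i != j ->
  dfwith (dfwith x s) t = dfwith (dfwith x t) s.
Proof.
move=> ij; apply: functional_extensionality_dep => k.
have [<-|ik] := eqVneq i k.
  by rewrite dfwith_in dfwith_out 1?eq_sym// dfwith_in.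
have [<-|jk] := eqVneq j k; first by rewrite dfwith_out// !dfwith_in.
by rewrite !dfwith_out.
Qed.

(* B is a bounded form in the variables indexed by S and ignores the others *)
Definition form_on (S : {set 'I_m}) (M : R) B :=
  [/\ 0 <= M,
      forall i, i \in S -> forall x, linear (fun t : E i => B (dfwith x t)),
      forall i, i \notin S -> forall x (t : E i), B (dfwith x t) = B x
    & forall x, `|B x| <= M * \prod_(i in S) `|x i| ].

Lemma form_on_slice S M B i x (t : E i) : form_on S M B -> i \in S ->
  `|B (dfwith x t)| <= M * \prod_(j in S :\ i) `|x j| * `|t|.
Proof.
case=> _ _ _ BM iS; apply: le_trans (BM _) _.
rewrite (big_setD1 i)//= dfwith_in mulrA mulrAC.
rewrite (eq_bigr (fun j => `|x j|))// => j; rewrite !inE => /andP[ji _].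
by rewrite dfwith_out// eq_sym.
Qed.

Lemma form_on_dual S M B i x : form_on S M B -> i \in S ->
  (fun t : E i => B (dfwith x t)) \in @dual_pred R (E i).
Proof.
move=> SB iS; apply: (dual_pred_bounded (M := M * \prod_(j in S :\ i) `|x j|)).
  by case: SB => _ + _ _; apply.
by move=> t; exact: form_on_slice.
Qed.

Lemma ab_stepE S M B i (x2 : dual (dual (E i))) x (SB : form_on S M B)
  (iS : i \in S) : ab_step x2 B x = x2 (Dual (form_on_dual x SB iS)).
Proof. by congr (x2 _); apply/val_inj; rewrite insubdK//; exact: form_on_dual SB iS. Qed.

Lemma form_on_step S M B i (x2 : dual (dual (E i))) :
  form_on S M B -> i \in S -> form_on (S :\ i) (M * `|x2|) (ab_step x2 B).
Proof.
move=> SB iS; have [M0 Bl Bi BM] := SB; split.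
- exact: mulr_ge0.
- move=> j; rewrite !inE => /andP[ji jS] x a s s'.
  rewrite !(ab_stepE _ _ SB iS) -linearP; congr (x2 _).
  have ij : i != j by rewrite eq_sym.
  apply/val_inj/funext => t /=; rewrite !fctE !(dfwithC _ t _ ij).
  exact: Bl.
- move=> j; rewrite !inE negb_and negbK => jS x t.
  rewrite !(ab_stepE _ _ SB iS); congr (x2 _); apply/val_inj/funext => s /=.
  have [ij|ij] := eqVneq i j; first by case: _ / ij t {jS} => t; rewrite dfwithK.
  rewrite dfwithC// Bi//.
  by move: jS; rewrite eq_sym (negbTE ij).
- move=> x; rewrite (ab_stepE _ _ SB iS); apply: le_trans (dual_ler _ _) _.
  rewrite mulrC mulrAC ler_wpM2r//; apply: dual_norm_ub => [|t].
    by rewrite mulr_ge0// prodr_ge0.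
  exact: form_on_slice.
Qed.

Lemma form_onP S M N B C a : form_on S M B -> form_on S N C ->
  form_on S (`|a| * M + N) (fun x => a * B x + C x).
Proof.
move=> [M0 Bl Bi BM] [N0 Cl Ci CN]; split.
- by rewrite addr_ge0// mulr_ge0.
- move=> i iS x b s t; rewrite Bl// Cl//.
  by rewrite /GRing.scale/=; lra.
- by move=> i iS x t; rewrite Bi// Ci.
- move=> x; apply: le_trans (ler_normD _ _) _.
  by rewrite mulrDl lerD// normrM -mulrA ler_wpM2l.
Qed.

Lemma ab_stepP S M N B C a i (x2 : dual (dual (E i))) :
  form_on S M B -> form_on S N C -> i \in S ->
  ab_step x2 (fun x => a * B x + C x) =
  (fun x => a * ab_step x2 B x + ab_step x2 C x).
Proof.
move=> SB SC iS; apply/funext => x.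
rewrite (ab_stepE _ _ SB iS) (ab_stepE _ _ SC iS).
rewrite (ab_stepE _ _ (form_onP a SB SC) iS) -[_ * _]/(_ *: _) -linearP.
by congr (x2 _); apply/val_inj.
Qed.

Section Iterate.
Variables (rho : 'S_m) (x2 : forall i, dual (dual (E i))).
Let step B k := ab_step (x2 (rho k)) B.

Lemma form_on_iter (s : seq 'I_m) (S : {set 'I_m}) M B : uniq s ->
  {in s, forall k, rho k \in S} -> form_on S M B ->
  form_on (S :\: [set rho k | k in s]%SET) (M * \prod_(k <- s) `|x2 (rho k)|)
    (foldl step B s).
Proof.
elim: s S M B => [|k s IH] S M B /=.
  by move=> _ _; rewrite big_nil mulr1 (_ : [set _ | _ in _]%SET = finset.set0) ?finset.setD0//;
     apply/setP => i; rewrite inE; apply/negbTE/imsetP => -[].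
move=> /andP[ks us] sS SB.
have kS : rho k \in S by apply: sS; rewrite mem_head.
have {}IH := IH _ _ _ us _ (form_on_step (x2 (rho k)) SB kS).
rewrite big_cons mulrA; rewrite (_ : S :\: _ = (S :\ rho k) :\: [set rho k | k in s]%SET).
  apply: IH => l ls; rewrite !inE sS ?inE ?ls ?orbT// andbT.
  by apply: contraNneq ks => /perm_inj <-.
apply/setP => i; rewrite !inE; have [->|ik] := eqVneq i (rho k).
  by rewrite andbF; apply/negbTE; rewrite negb_and negbK imset_f// mem_head.
congr (~~ _ && _); apply/imsetP/imsetP => -[l ls il]; exists l => //; last first.
  by rewrite inE ls orbT.
by move: ls ik; rewrite il inE => /predU1P[->|//]; rewrite eqxx.
Qed.

Lemma iterP (s : seq 'I_m) (S : {set 'I_m}) M N B C a : uniq s ->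
  {in s, forall k, rho k \in S} -> form_on S M B -> form_on S N C ->
  foldl step (fun x => a * B x + C x) s =
  (fun x => a * foldl step B s x + foldl step C s x).
Proof.
elim: s S M N B C => [//|k s IH] S M N B C /= /andP[ks us] sS SB SC.
have kS : rho k \in S by apply: sS; rewrite mem_head.
rewrite {2}/step (ab_stepP _ _ SB SC kS).
apply: (IH _ _ _ _ _ us _ (form_on_step _ SB kS) (form_on_step _ SC kS)).
move=> l ls; rewrite !inE sS ?inE ?ls ?orbT// andbT.
by apply: contraNneq ks => /perm_inj <-.
Qed.

End Iterate.

Variable F : normedModType R.

Lemma multilinear_scale (A : (forall i, E i) -> F) (c : 'I_m -> R) x :
  multilinear A -> A (fun i => c i *: x i) = (\prod_i c i) *: A x.
Proof.
move=> lA.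
suff H (s : seq 'I_m) : uniq s ->
    A (fun i => if i \in s then c i *: x i else x i) = (\prod_(i <- s) c i) *: A x.
  have := H _ (index_enum_uniq _); rewrite -big_enum/= => <-.
  by congr (A _); apply: functional_extensionality_dep => i; rewrite mem_index_enum.
elim: s => [|k s IH] /=; first by rewrite big_nil scale1r.
move=> /andP[ks us]; rewrite big_cons -scalerA -IH//.
set z := (fun i => if i \in s then _ else _).
have zE : z = dfwith z (x k).
  apply: functional_extensionality_dep => i; have [<-|ki] := eqVneq k i.
    by rewrite dfwith_in /z (negbTE ks).
  by rewrite dfwith_out.
pose L : {linear E k -> F} := HB.pack (fun t : E k => A (dfwith z t))
  (GRing.isLinear.Build _ _ _ _ _ (lA k z)).
rewrite [in RHS]zE -[RHS]/(c k *: L (x k)) -linearZ /=; congr (A _).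
apply: functional_extensionality_dep => i; rewrite inE.
have [->|ki] := eqVneq i k; first by rewrite dfwith_in.
by rewrite dfwith_out// eq_sym.
Qed.

Lemma cts_multilinear_bounded (A : (forall i, E i) -> F) : cts_multilinear A ->
  exists M, 0 <= M /\ forall x, `|A x| <= M * \prod_i `|x i|.
Proof.
move=> [lA cA].
pose G : set_system (prod_topology E) :=
  filter_from [set d : R | 0 < d] (fun d => [set x | forall i, `|x i| < d]).
have GF : Filter G.
  apply: filter_from_filter; first by exists 1 => /=.
  move=> d e /= d0 e0; exists (Num.min d e); first by rewrite /= lt_min d0.
  by move=> x /= xde; split=> i; have := xde i; rewrite lt_min => /andP[].
pose z : prod_topology E := fun i => 0.
have G0 : G --> z.
  apply/cvg_sup => i U /= [V [[W oW <-] Wz] /filterS]; apply.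
  have : nbhs (0 : E i) W by apply: open_nbhs_nbhs; split.
  move/nbhs_norm0P => [e /= e0 eW]; exists e => //= x xe; apply: eW; exact: xe.
have /cvgr_norm_le : A @ G --> A z by apply: cvg_trans (cA z); exact: cvg_app.
move=> /(_ (`|A z| + 1))[|d /= d0 dA]; first by rewrite ltrDl.
set K := `|A z| + 1 in dA; have K0 : 0 <= K by rewrite addr_ge0.
exists (K * (2 / d) ^+ m); split.
  by rewrite mulr_ge0// exprn_ge0// divr_ge0// ltW.
move=> x; have [/existsP[i /eqP xi]|/existsPn x0] := boolP [exists i, x i == 0].
  have -> : A x = 0.
    pose L : {linear E i -> F} := HB.pack (fun t : E i => A (dfwith x t))
      (GRing.isLinear.Build _ _ _ _ _ (lA i x)).
    have <- : L 0 = 0 by rewrite linear0.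
    congr (A _); apply: functional_extensionality_dep => j.
    have [<-|ij] := eqVneq i j; first by rewrite dfwith_in.
    by rewrite dfwith_out.
  by rewrite normr0 mulr_ge0 ?prodr_ge0// mulr_ge0// exprn_ge0// divr_ge0// ltW.
have nx i : 0 < `|x i| by rewrite normr_gt0 x0.
pose c i := d / 2 / `|x i|.
have c0 i : 0 < c i by rewrite !divr_gt0.
have /dA : forall i, `|c i *: x i| < d.
  move=> i; rewrite normrZ gtr0_norm// divfK ?gt_eqF//.
  by rewrite ltr_pdivrMr// ltr_pMr// ltr1n.
rewrite /= multilinear_scale// normrZ ger0_norm; last first.
  by rewrite prodr_ge0// => i _; exact: ltW.
move=> h; have P0 : 0 < \prod_i c i by rewrite prodr_gt0.
rewrite -(ler_pM2l P0); apply: le_trans h _.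
rewrite -[K * _ * _]mulrA mulrCA [X in K * X]mulrCA -big_split/=.
under eq_bigr do rewrite divfK ?gt_eqF//.
rewrite prodr_const card_ord -exprMn (_ : 2 / d * (d / 2) = 1) ?expr1n ?mulr1//.
by rewrite mulrA divfK ?divff ?pnatr_eq0 ?gt_eqF.
Qed.

Lemma form_on_comp (A : (forall i, E i) -> F) : cts_multilinear A ->
  exists M, 0 <= M /\
    forall y : dual F, form_on [set: 'I_m]%SET (M * `|y|) (y \o A).
Proof.
move=> cA; have [M [M0 AM]] := cts_multilinear_bounded cA.
exists M; split=> // y; split.
- exact: mulr_ge0.
- by move=> i _ x a s t /=; rewrite cA.1 linearP.
- by move=> i; rewrite inE.
- move=> x /=; apply: le_trans (dual_ler _ _) _.
  rewrite mulrAC mulrC ler_wpM2r//; apply: le_trans (AM x) _.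
  by rewrite [X in _ <= _ * X](eq_bigl xpredT)// => i; rewrite inE.
Qed.

Lemma aron_berner_dual rho (A : (forall i, E i) -> F)
    (x2 : forall i, dual (dual (E i))) : cts_multilinear A ->
  (fun y : dual F => ab_form rho x2 (y \o A) (fun=> 0)) \in
  @dual_pred R (dual F).
Proof.
move=> /form_on_comp[M [M0 yA]].
have h : {in enum 'I_m, forall k, rho k \in [set: 'I_m]%SET}.
  by move=> k _; rewrite inE.
apply: (dual_pred_bounded (M := M * \prod_(k <- enum 'I_m) `|x2 (rho k)|)).
  move=> a y y'; have := iterP (rho := rho) x2 a (enum_uniq 'I_m) h (yA y) (yA y').
  by move=> /(congr1 (fun f => f (fun=> 0))).
move=> y; have [_ _ _] := form_on_iter (rho := rho) x2 (enum_uniq 'I_m) h (yA y).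
move/(_ (fun=> 0)); rewrite [X in _ <= _ * X]big1 ?mulr1; last first.
  move=> i; rewrite !inE andbT => /negP[]; apply/imsetP.
  by exists (rho^-1 i)%g; rewrite ?mem_enum// permKV.
by rewrite mulrAC.
Qed.

Lemma aron_bernerE rho (A : (forall i, E i) -> F)
    (x2 : forall i, dual (dual (E i))) (y : dual F) : cts_multilinear A ->
  aron_berner rho A x2 y = ab_form rho x2 (y \o A) (fun=> 0).
Proof.
by move=> cA; rewrite /aron_berner -[LHS]/(val _ y) insubdK//;
  exact: aron_berner_dual.
Qed.

End AronBernerTheory.

(* Main.v *)
(* (d) => (a). An Aron-Berner extension B of A satisfies |B x| <= M prod |x_j|, *)
(* weakly null sequences are bounded, and in a space with the positive Schur    *)
(* property disjoint weakly null sequences are norm null.                       *)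
(*                                                                              *)
(* (c) => (d). If F contains linf, some positive sequence y_n, bounded away     *)
(* from 0 in norm, has order bounded partial sums: otherwise increasing order   *)
(* bounded sequences converge; a copy T of linf satisfies phi |T e_n| -> 0 for  *)
(* every positive phi by a Khinchine inequality, so functionals norming the     *)
(* T e_n can be made disjoint, hence weak-star null, which contradicts          *)
(* Phillips' lemma. If moreover no E_j^** has the positive Schur property,      *)
(* there are positive disjoint weakly null w_{j,n} in E_j^** and positive       *)
(* v_{j,n} in the unit ball of E_j^* with w_{j,n} (v_{j,n}) >= e_j > 0. For the *)
(* positive operator A x = sum_n (prod_j v_{j,n} (x_j)) y_n, every Aron-Berner  *)
(* extension takes at (w_{1,n}, ..., w_{m,n}) a value of norm at least          *)
(* |y_n| prod_j e_j.                                                            *)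

Require Import Defs.
From HB Require Import structures.
From mathcomp Require Import all_boot all_order all_algebra all_fingroup.
From mathcomp Require Import boolp classical_sets functions cardinality reals.
From mathcomp Require Import topology normedtype sequences.
From mathcomp Require Import ring lra zify.

Set Implicit Arguments.
Unset Strict Implicit.
Unset Printing Implicit Defensive.

Import Order.TTheory GRing.Theory Num.Theory.
Import numFieldNormedType.Exports.

Local Open Scope classical_set_scope.
Local Open Scope ring_scope.

(** * Hahn-Banach theorem *)

(** Why one good factor suffices: an Aron-Berner extension is bounded by a multiple of the product
    of the norms ([aron_berner_le]). Along disjoint weakly null sequences the factor with the
    positive Schur property tends to 0 ([positive_Schur_disjoint]) and the others stay bounded
    ([weakly_null_bounded]).

    Conversely, if no factor is good, one positive operator defeats every permutation. It is the
    diagonal operator A x = sum_n (prod_j v_{j,n} (x_j)) y_n. Positive terms do not cancel, so at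
    positive arguments each extension is bounded below by the n-th term alone, in whatever order the
    variables are extended ([ab_iter_ge], [product_aron_berner_ge]).

    The range supplies y_n with norms bounded below and order bounded partial sums
    ([contains_linf_separated_series]); sigma-Dedekind completeness then sums the series for all
    bounded coefficients ([order_sum_exists]). The copy of [linf] need not be a sublattice, so the
    y_n are not read off from it: without such a series, disjointified norming functionals would be
    weak-star null ([disjointified_null]), against Phillips' lemma ([phillips]).

    The domain supplies disjoint positive weakly null sequences in E_j^**, bounded below on positive
    elements v_{j,n} of the unit ball of E_j^* ([not_positive_Schur_dual]). The predual E_j^*
    suffices for testing because it norms E_j^**.

    The implications between the operator classes rest on the continuity of regular operators
    ([regular_multilinear_continuous]). *)

Section HahnBanach.
Variables (R : realType) (V : lmodType R).
Implicit Types p q f : V -> R.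

Definition sublinear p :=
  (forall x y, p (x + y) <= p x + p y) /\
  (forall a x, 0 <= a -> p (a *: x) = a * p x).

Lemma sublinear0 p : sublinear p -> p 0 = 0.
Proof. by move=> [_ /(_ 0 0 (lexx _))]; rewrite scale0r mul0r. Qed.

Lemma sublinear_geN p x : sublinear p -> - p (- x) <= p x.
Proof.
by move=> sp; have := sp.1 x (- x); rewrite subrr (sublinear0 sp); lra.
Qed.

(** Serves both for chains in Zorn's lemma and for the family that defines [sublinear_slide]; the
    third hypothesis is the directedness that lets two members be replaced by one. *)
Lemma sublinear_inf (A : set (V -> R)) : A !=set0 ->
  (forall x, exists c, forall f, A f -> c <= f x) ->
  (forall f g x y, A f -> A g -> exists2 h, A h & h (x + y) <= f x + g y) ->
  (forall a f x, 0 < a -> A f -> exists2 h, A h & h (a *: x) <= a * f x) ->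
  sublinear (fun x => inf [set f x | f in A]).
Proof.
move=> A0 lbA addA scaleA; set q := fun x => _.
have ne x : [set f x | f in A] !=set0 by have [f Af] := A0; exists (f x), f.
have lb x : has_lbound [set f x | f in A].
  by have [c cA] := lbA x; exists c => _ [f Af <-]; exact: cA.
have qle f x : A f -> q x <= f x by move=> Af; apply: ge_inf => //; exists f.
have le_q x c : (forall g, A g -> c <= g x) -> c <= q x.
  by move=> cA; apply: lb_le_inf => // _ [g Ag <-]; exact: cA.
have qZ a x : 0 < a -> q (a *: x) <= a * q x.
  move=> a0; rewrite mulrC -ler_pdivrMr//; apply: le_q => f Af.
  have [h Ah hf] := scaleA _ _ x a0 Af.
  by rewrite ler_pdivrMr// [_ * a]mulrC (le_trans _ hf)// qle.
have qZe a x : 0 < a -> q (a *: x) = a * q x.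
  move=> a0; apply/eqP; rewrite eq_le qZ//= mulrC -ler_pdivlMr// mulrC.
  have := qZ a^-1 (a *: x); rewrite scalerA mulVf ?gt_eqF// scale1r.
  by apply; rewrite invr_gt0.
split=> [x y|a x].
  rewrite -lerBlDr; apply: (le_q) => f Af; rewrite lerBlDl -lerBlDr.
  apply: le_q => g Ag; rewrite lerBlDr.
  have [h Ah hfg] := addA _ _ x y Af Ag.
  by rewrite [g y + _]addrC (le_trans _ hfg)// qle.
rewrite le_eqVlt => /predU1P[<-|/qZe//]; rewrite scale0r mul0r.
by have := qZe 2 0 (ltr0Sn _ 1); rewrite scaler0; lra.
Qed.

(** Lowers [p] so that its value at [- y] is at most [- p y]: every linear minorant of the result
    then equals [p] at [y]. *)
Definition sublinear_slide p y x :=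
  inf [set f x | f in [set fun x => p (x + t *: y) - t * p y | t in [set t : R | 0 <= t]]].

Lemma sublinear_slideP p y : sublinear p ->
  [/\ sublinear (sublinear_slide p y), forall x, sublinear_slide p y x <= p x &
      forall x, sublinear_slide p y x <= p (x + y) - p y].
Proof.
move=> sp; set A := [set fun x => p (x + t *: y) - t * p y | t in [set t : R | 0 <= t]].
have lbA x : exists c, forall f, A f -> c <= f x.
  exists (- p (- x)) => _ [t /= t0 <-] /=.
  by have := sp.1 (x + t *: y) (- x); rewrite addrAC subrr add0r sp.2//; lra.
have le_slide t x : 0 <= t -> sublinear_slide p y x <= p (x + t *: y) - t * p y.
  move=> t0; apply: ge_inf; last by exists (fun x => p (x + t *: y) - t * p y) => //; exists t.
  by have [c cA] := lbA x; exists c => _ [f Af <-]; exact: cA.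
split; last 2 first.
- by move=> x; have := le_slide 0 x (lexx _); rewrite scale0r addr0; lra.
- by move=> x; have := le_slide 1 x ler01; rewrite scale1r; lra.
apply: sublinear_inf => //.
- by exists (fun x => p (x + 0 *: y) - 0 * p y); exists 0 => /=.
- move=> _ _ x z [t /= t0 <-] [s /= s0 <-].
  exists (fun x => p (x + (t + s) *: y) - (t + s) * p y); first by exists (t + s) => //=; exact: addr_ge0.
  by have := sp.1 (x + t *: y) (z + s *: y); rewrite addrACA -scalerDl; lra.
- move=> a _ x a0 [t /= t0 <-].
  exists (fun x => p (x + (a * t) *: y) - (a * t) * p y).
    by exists (a * t) => //=; rewrite mulr_ge0// ltW.
  rewrite /= -scalerA -scalerDr (sp.2 _ _ (ltW a0)); lra.
Qed.

(* A minimal sublinear functional is linear, so Zorn's lemma is applied to the *)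
(* sublinear functionals below p rather than to partial linear functionals.    *)
Lemma sublinear_minorant p : sublinear p ->
  exists2 f : V -> R, linear f & forall x, f x <= p x.
Proof.
move=> sp; pose T := {q : V -> R | sublinear q /\ forall x, q x <= p x}.
pose r (s t : T) := `[< forall x, sval t x <= sval s x >].
have [||A tA|m mmax] := @ZL_preorder T (exist _ p (conj sp (fun=> lexx _))) r.
- by move=> t; apply/asboolP.
- by move=> s t u /asboolP ts /asboolP su; apply/asboolP => x; exact: le_trans (su x) (ts x).
- have [/eqP A0|/set0P[t0 At0]] := boolP (A == set0).
    by exists (exist _ p (conj sp (fun=> lexx _))) => s; rewrite A0.
  pose B := [set sval t | t in A]; pose q x := inf [set f x | f in B].
  have lbB x : exists c, forall f, B f -> c <= f x.
    exists (- p (- x)) => _ [t _ <-].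
    by rewrite (le_trans _ (sublinear_geN x (svalP t).1))// lerN2 (svalP t).2.
  have qB f x : B f -> q x <= f x.
    move=> Bf; apply: ge_inf; last by exists f.
    by have [c cB] := lbB x; exists c => _ [g Bg <-]; exact: cB.
  have Bp f : B f -> sublinear f by move=> [t _ <-]; exact: (svalP t).1.
  have sq : sublinear q.
    apply: sublinear_inf => //; first by exists (sval t0), t0.
    - move=> _ _ x y [s As <-] [t At <-].
      have [/asboolP h|/asboolP h] := tA _ _ As At.
        exists (sval t); first by exists t.
        by rewrite (le_trans ((svalP t).1.1 _ _))// lerD2r.
      exists (sval s); first by exists s.
      by rewrite (le_trans ((svalP s).1.1 _ _))// lerD2l.
    - by move=> a f x a0 Bf; exists f => //; rewrite (Bp _ Bf).2// ltW.
  have qp x : q x <= p x by rewrite (le_trans (qB _ _ (imageP _ At0)))// (svalP t0).2.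
  by exists (exist _ q (conj sq qp)) => s As; apply/asboolP => x; apply: qB; exists s.
case: m mmax => q [sq qp] qmin; exists q => //.
have qD x y : q (x + y) = q x + q y.
  apply/eqP; rewrite eq_le sq.1 -lerBrDr/=.
  have [s1 s2 s3] := sublinear_slideP y sq.
  have sp' z : sublinear_slide q y z <= p z by exact: le_trans (s2 z) (qp z).
  (* Minimality makes [q] lie below its own slide, whose value at [x] is at most [q (x + y) - q y];
     this is superadditivity. *)
  have /asboolP/= h : r (exist _ (sublinear_slide q y) (conj s1 sp')) (exist _ q (conj sq qp)).
    by apply: qmin; apply/asboolP => z /=.
  exact: le_trans (h x) (s3 x).
have q0 := sublinear0 sq.
have qN x : q (- x) = - q x.
  by apply/eqP; rewrite -addr_eq0 -qD addNr q0.
move=> a x y; rewrite qD; congr (_ + _); have [a0|/ltW a0] := leP 0 a; first exact: sq.2.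
by rewrite -[a in LHS]opprK scaleNr qN sq.2 ?oppr_ge0// mulNr opprK.
Qed.

Lemma hahn_banach p y : sublinear p ->
  exists f : V -> R, [/\ linear f, forall x, f x <= p x & f y = p y].
Proof.
move=> sp; have [s1 s2 s3] := sublinear_slideP y sp.
have [f lf fs] := sublinear_minorant s1; exists f; split=> //.
  by move=> x; exact: le_trans (fs x) (s2 x).
pose g : {linear V -> R} := HB.pack f (GRing.isLinear.Build _ _ _ _ _ lf).
apply/eqP; rewrite eq_le (le_trans (fs y) (s2 y))/=.
have := le_trans (fs (- y)) (s3 (- y)).
by rewrite addNr (sublinear0 sp) -[f]/(g : V -> R) linearN; lra.
Qed.

End HahnBanach.

(** * Vector lattices and positive functionals *)

Section VectorLattice.
Variables (R : realType) (E : banachLatticeType R).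
Implicit Types (x y z u v w : E) (a b : R).

Lemma vle_add2l z x y : x <=v y -> z + x <=v z + y.
Proof. by rewrite ![z + _]addrC; exact: vle_add2r. Qed.

Lemma vlerBl x y z : x - y <=v z <-> x <=v z + y.
Proof.
by split=> [/(vle_add2r y)|/(vle_add2r (- y))]; rewrite ?subrK ?addrK.
Qed.

Lemma vle_scale a x y : 0 <= a -> x <=v y -> a *: x <=v a *: y.
Proof.
move=> a0 /vsubr_ge0 xy; apply/vsubr_ge0; rewrite -scalerBr.
exact: vle_scale_ge0.
Qed.

Lemma vle_scalel a b x : a <= b -> 0 <=v x -> a *: x <=v b *: x.
Proof.
move=> ab x0; apply/vsubr_ge0; rewrite -scalerBl; apply: vle_scale_ge0 => //.
by rewrite subr_ge0.
Qed.

Lemma vsum_ge0 (I : Type) (s : seq I) (P : pred I) (F : I -> E) :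
  (forall i, P i -> 0 <=v F i) -> 0 <=v \sum_(i <- s | P i) F i.
Proof.
by move=> F0; elim/big_ind : _ => //; [exact: vle_refl|exact: vaddr_ge0].
Qed.

Lemma vle_norm0 x y : 0 <=v x -> x <=v y -> `|x| <= `|y|.
Proof. by move=> x0 xy; apply: vle_norm_pos; rewrite vabs_pos. Qed.

Lemma norm_vabs x : `|vabs x| = `|x|.
Proof.
have h : vabs (vabs x) = vabs x by apply: vabs_pos; exact: vabs_ge0.
by apply/eqP; rewrite eq_le; apply/andP; split; apply: vle_norm;
  rewrite -!/(vabs _) h; exact: vle_refl.
Qed.

Lemma vabsN x : vabs (- x) = vabs x.
Proof.
rewrite /vabs opprK; apply: vle_anti;
  by apply: vle_sup; [exact: vle_supr|exact: vle_supl].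
Qed.

Lemma vle_abs x : x <=v vabs x. Proof. exact: vle_supl. Qed.

Lemma vle_absN x : - x <=v vabs x. Proof. exact: vle_supr. Qed.

Lemma vabsD x y : vabs (x + y) <=v vabs x + vabs y.
Proof.
apply: vle_sup; first by apply: vleD; exact: vle_abs.
by rewrite opprD; apply: vleD; exact: vle_absN.
Qed.

Lemma vle_pos x : x <=v vpos x. Proof. exact: vle_supl. Qed.

Lemma vpos_le x y : x <=v y -> vpos x <=v vpos y.
Proof.
move=> xy; apply: vle_sup; last exact: vpos_ge0.
exact: vle_trans xy (vle_pos y).
Qed.

Lemma vpos_id x : 0 <=v x -> vpos x = x.
Proof.
move=> x0; apply: vle_anti; last exact: vle_pos.
by apply: vle_sup => //; exact: vle_refl.
Qed.

Lemma vpos_eq0 x : x <=v 0 -> vpos x = 0.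
Proof.
move=> x0; apply: vle_anti; last exact: vpos_ge0.
by apply: vle_sup => //; exact: vle_refl.
Qed.

Lemma vposN x : vpos (- x) = vpos x - x.
Proof.
apply: vle_anti.
  apply: vle_sup; last exact: vneg_ge0.
  by rewrite -[X in X <=v _]add0r; apply: vle_add2r; exact: vpos_ge0.
apply/vlerBl; apply: vle_sup.
  by rewrite -[X in X <=v _]add0r; apply: vle_add2r; exact: vpos_ge0.
by apply/vlerBl; rewrite sub0r; exact: vle_pos.
Qed.

Lemma vabsE x : vabs x = vpos x + vpos (- x).
Proof.
apply: vle_anti.
  apply: vle_sup.
    rewrite -[X in X <=v _]addr0; apply: vleD; [exact: vle_pos|exact: vpos_ge0].
  by rewrite -[X in X <=v _]add0r; apply: vleD; [exact: vpos_ge0|exact: vle_pos].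
rewrite vposN addrA; apply/vlerBl.
have xx : x + x <=v vabs x + x by apply: vle_add2r; exact: vle_abs.
have h : vpos x <=v 2^-1 *: (vabs x + x).
  apply: vle_sup.
    apply: (@vle_trans _ _ (2^-1 *: (x + x))); last by apply: vle_scale => //; rewrite invr_ge0.
    rewrite scalerDr -scalerDl -[X in (X + X) *: _]div1r -splitr scale1r; exact: vle_refl.
  apply: vle_scale_ge0; [by rewrite invr_ge0|rewrite -[0](addNr x)]; apply: vle_add2r.
  exact: vle_absN.
by have := vleD h h; rewrite -scalerDl -[X in (X + X) *: _]div1r -splitr scale1r.
Qed.

Lemma vposD x y : vpos (x + y) <=v vpos x + vpos y.
Proof.
apply: vle_sup; last exact: vaddr_ge0 (vpos_ge0 x) (vpos_ge0 y).
by apply: vleD; exact: vle_pos.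
Qed.

Lemma vposZ a x : 0 <= a -> vpos (a *: x) = a *: vpos x.
Proof.
rewrite le_eqVlt => /predU1P[<-|a0].
  by rewrite !scale0r; apply: vpos_id; exact: vle_refl.
have H b y : 0 <= b -> vpos (b *: y) <=v b *: vpos y.
  move=> b0; apply: vle_sup; first by apply: vle_scale => //; exact: vle_pos.
  by apply: vle_scale_ge0 => //; exact: vpos_ge0.
apply: vle_anti; first exact/H/ltW.
have := vle_scale (ltW a0) (H a^-1 (a *: x) _).
rewrite !scalerA mulVf ?mulfV ?gt_eqF// !scale1r; apply.
by rewrite invr_ge0 ltW.
Qed.

Lemma vabsZ a x : vabs (a *: x) = `|a| *: vabs x.
Proof.
wlog a0 : a / 0 <= a.
  move=> H; have [/H//|/ltW a0] := leP 0 a.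
  by rewrite -vabsN -scaleNr H ?oppr_ge0// normrN.
by rewrite !vabsE -scalerN !vposZ// -scalerDr ger0_norm.
Qed.

Lemma vle_scale_abs a x : a *: x <=v `|a| *: vabs x.
Proof. by rewrite -vabsZ; exact: vle_abs. Qed.

Lemma norm_vpos_le x y : x <=v y -> `|vpos x| <= `|y|.
Proof.
move=> xy; apply: le_trans (norm_vpos y); apply: vle_norm0.
  exact: vpos_ge0.
exact: vpos_le.
Qed.

Lemma vinfC x y : vinf x y = vinf y x.
Proof.
by apply: vle_anti; apply: vle_inf; do ?[exact: vle_infl|exact: vle_infr].
Qed.

Lemma vinf_ge0 x y : 0 <=v x -> 0 <=v y -> 0 <=v vinf x y.
Proof. exact: vle_inf. Qed.

Lemma vinf_le x y u v : x <=v u -> y <=v v -> vinf x y <=v vinf u v.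
Proof.
move=> xu yv; apply: vle_inf.
  exact: vle_trans (vle_infl _ _) xu.
exact: vle_trans (vle_infr _ _) yv.
Qed.

Lemma vinfE x y : vinf x y = x - vpos (x - y).
Proof.
apply: vle_anti.
  apply/vsubr_ge0; rewrite addrAC; apply/vsubr_ge0; apply: vle_sup.
    by apply: vle_add2l; apply: vleN; exact: vle_infr.
  by apply/vsubr_ge0; exact: vle_infl.
apply: vle_inf; apply/vlerBl.
  by rewrite -[X in X <=v _]addr0; apply: vle_add2l; exact: vpos_ge0.
by rewrite addrC; apply/vlerBl; exact: vle_pos.
Qed.

Lemma vinf_pos_neg x : vinf (vpos x) (vpos (- x)) = 0.
Proof.
by rewrite vinfE vposN subKr subrr.
Qed.

Lemma vinfDr u v w : 0 <=v u -> 0 <=v v -> 0 <=v w ->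
  vinf u (v + w) <=v vinf u v + vinf u w.
Proof.
move=> u0 v0 w0; set t := vinf u (v + w).
have t0 : 0 <=v t by apply: vinf_ge0 => //; exact: vaddr_ge0.
have tu : t <=v u by exact: vle_infl.
have [t1 [t2 [tE [t10 t1v] [t20 t2w]]]] :=
  vriesz t0 w0 v0 (vle_infr u (v + w) : t <=v v + w).
rewrite {1}tE; apply: vleD; apply: vle_inf => //; apply: vle_trans tu; rewrite tE.
  by rewrite -[X in X <=v _]addr0; exact: vle_add2l.
by rewrite -[X in X <=v _]add0r; exact: vle_add2r.
Qed.

Lemma vinf_disjD u v w : 0 <=v u -> 0 <=v v -> 0 <=v w ->
  vinf u v = 0 -> vinf u w = 0 -> vinf u (v + w) = 0.
Proof.
move=> u0 v0 w0 uv uw; apply: vle_anti.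
  by have := vinfDr u0 v0 w0; rewrite uv uw addr0.
by apply: vinf_ge0 => //; exact: vaddr_ge0.
Qed.

Lemma vinfZ a u v : 0 <= a -> vinf (a *: u) (a *: v) = a *: vinf u v.
Proof. by move=> a0; rewrite !vinfE -scalerBr vposZ// -scalerBr. Qed.

Lemma vinf_disjZ a u v : 0 <=v u -> 0 <=v v -> 0 <= a ->
  vinf u v = 0 -> vinf u (a *: v) = 0.
Proof.
move=> u0 v0 a0 uv; apply: vle_anti; last first.
  by apply: vinf_ge0 => //; exact: vle_scale_ge0.
have a1 : 0 <= a + 1 by rewrite addr_ge0.
rewrite -[X in _ <=v X](scaler0 _ (a + 1)) -uv -vinfZ//; apply: vinf_le.
  by rewrite -[X in X <=v _]scale1r; apply: vle_scalel => //; lra.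
by apply: vle_scalel => //; lra.
Qed.

Lemma vinf_disj_le x y u v : 0 <=v x -> 0 <=v y -> x <=v u -> y <=v v ->
  vinf u v = 0 -> vinf x y = 0.
Proof.
move=> x0 y0 xu yv uv; apply: vle_anti; last exact: vinf_ge0.
by rewrite -uv; exact: vinf_le.
Qed.

(** Since [- l <=v u n - l], the norm of [vpos (- l)] is at most the distance from [u n] to [l]. *)
Lemma vge0_cvg (u : nat -> E) l : (forall n, 0 <=v u n) ->
  u @ \oo --> l -> 0 <=v l.
Proof.
move=> u0 ul; suff : `|vpos (- l)| == 0.
  by rewrite normr_eq0 vposN subr_eq0 => /eqP <-; exact: vpos_ge0.
rewrite eq_le normr_ge0 andbT; apply/ler_addgt0Pr => e e0; rewrite add0r.
have /cvgrPdist_le/(_ e e0)[N _ /(_ N (leqnn _))/=] := ul.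
apply: le_trans; rewrite distrC; apply: norm_vpos_le.
by rewrite -[X in X <=v _]add0r; exact: vle_add2r.
Qed.

Lemma vle_cvg (u v : nat -> E) l k : (forall n, u n <=v v n) ->
  u @ \oo --> l -> v @ \oo --> k -> l <=v k.
Proof.
move=> uv ul vk; apply/vsubr_ge0.
apply: (@vge0_cvg (fun n => v n - u n)); last exact: cvgB.
by move=> n; apply/vsubr_ge0.
Qed.

End VectorLattice.

Lemma dual_cvg (R : realType) (V : normedModType R) (f : dual V) (u : nat -> V) l :
  u @ \oo --> l -> f (u n) @[n --> \oo] --> f l.
Proof. by move=> ul; apply: (cvg_comp _ _ ul); exact: dual_continuous. Qed.

(** * Positive functionals: norming, minorants, extension from the cone *)

Section PositiveFunctionals.
Variables (R : realType) (E : banachLatticeType R).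
Implicit Types (x y u v : E) (f g h : dual E).

Lemma dual_ge0 f x : 0 <=v f -> 0 <=v x -> 0 <= f x.
Proof. exact. Qed.

Lemma dual_le f x y : 0 <=v f -> x <=v y -> f x <= f y.
Proof. by move=> f0 /vsubr_ge0 xy; rewrite -subr_ge0 -linearB; exact: f0. Qed.

Lemma dual_abs_le f x : 0 <=v x -> `|f x| <= vabs f x.
Proof.
by move=> x0; have := dual_ler_dabs f x; rewrite vpos_id// subrr addr0.
Qed.

Lemma dual_sublinear f : 0 <=v f -> sublinear (fun x => f (vpos x)).
Proof.
move=> f0; split=> [x y|a x a0]; last by rewrite vposZ// linearZ.
by rewrite -linearD; apply: dual_le => //; exact: vposD.
Qed.

Lemma dominated_dual (p : E -> R) (f : E -> R) M : linear f ->
  (forall x, f x <= p x) -> (forall x, p x <= M * `|x|) -> f \in @dual_pred R E.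
Proof.
move=> lf fp pM; apply: (@dual_pred_bounded _ _ _ M) => // x.
pose g : {linear E -> R} := HB.pack f (GRing.isLinear.Build _ _ _ _ _ lf).
rewrite ler_norml (le_trans (fp x) (pM x)) andbT lerNl -[f x]/(g x) -linearN.
by rewrite -(normrN x) (le_trans (fp _))// normrN pM// normrN.
Qed.

(** Hahn-Banach for the seminorm-like functional [|vpos y|]. It vanishes at negative elements, which
    makes its linear minorants positive, and it is below the norm. *)
Lemma positive_norming x : exists f, [/\ 0 <=v f, `|f| <= 1 & f (vabs x) = `|x|].
Proof.
have sp : sublinear (fun y : E => `|vpos y|).
  split=> [y z|a y a0]; last by rewrite vposZ// normrZ ger0_norm.
  apply: le_trans (ler_normD _ _); apply: vle_norm0; first exact: vpos_ge0.
  exact: vposD.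
have [f [lf fp fx]] := hahn_banach (vabs x) sp.
have fd : f \in @dual_pred R E.
  by apply: (dominated_dual (M := 1) lf fp) => y; rewrite mul1r norm_vpos.
exists (Dual fd); split.
- move=> y y0; change (0 <= f y); rewrite -[f y]/((Dual fd) y) -[y]opprK linearN oppr_ge0/=.
  rewrite (le_trans (fp _))//; rewrite vpos_eq0 ?normr0//.
  exact: voppr_le0.
- apply: dual_norm_ub => // y; rewrite mul1r ler_norml; apply/andP; split.
    rewrite lerNl -linearN (le_trans (fp _))// (le_trans (norm_vpos _))//.
    by rewrite normrN.
  by rewrite (le_trans (fp _))// norm_vpos.
- by rewrite /= fx vpos_id ?norm_vabs//; exact: vabs_ge0.
Qed.

(** Hahn-Banach for [h (vpos y)]: a linear minorant lies between 0 and [h], because this functional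
    is 0 at negative and [h] at positive elements. *)
Lemma positive_part_attained h u : 0 <=v h ->
  exists g, [/\ 0 <=v g, g <=v h & g u = h (vpos u)].
Proof.
move=> h0; have [f [lf fp fu]] := hahn_banach u (dual_sublinear h0).
have fd : f \in @dual_pred R E.
  apply: (dominated_dual (M := `|h|) lf fp) => y.
  by rewrite (le_trans (ler_norm _))// (le_trans (dual_ler _ _))// ler_wpM2l// norm_vpos.
exists (Dual fd); split=> // y y0 /=.
  change (0 <= f y); rewrite -[f y]/((Dual fd) y) -[y]opprK linearN oppr_ge0/=.
  rewrite (le_trans (fp _))// vpos_eq0 ?linear0//.
  exact: voppr_le0.
by rewrite (le_trans (fp _))// vpos_id.
Qed.

Lemma cone_extension (phi : E -> R) M :
  (forall x y, 0 <=v x -> 0 <=v y -> phi (x + y) = phi x + phi y) ->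
  (forall a x, 0 < a -> 0 <=v x -> phi (a *: x) = a * phi x) ->
  (forall x, 0 <=v x -> `|phi x| <= M * `|x|) ->
  exists f, forall x, 0 <=v x -> f x = phi x.
Proof.
move=> phiD phiZ phiM.
have phi0 : phi 0 = 0.
  by have := phiM 0 (vle_refl _); rewrite normr0 mulr0 normr_le0 => /eqP.
pose f x := phi (vpos x) - phi (vpos (- x)).
have fE u v : 0 <=v u -> 0 <=v v -> f (u - v) = phi u - phi v.
  move=> u0 v0; rewrite /f; have p0 := vpos_ge0 (u - v).
  have n0 := vpos_ge0 (- (u - v)).
  have /(congr1 phi) : vpos (u - v) + v = vpos (- (u - v)) + u.
    by rewrite vposN opprB addrA subrK.
  by rewrite !phiD//; lra.
have xE x : x = vpos x - vpos (- x) by rewrite vposN subKr.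
have fl : linear f.
  have fD x y : f (x + y) = f x + f y.
    rewrite {1}(xE x) {1}(xE y) addrACA -opprD fE.
    - by rewrite !phiD ?/f; try exact: vpos_ge0; lra.
    - by apply: vaddr_ge0; exact: vpos_ge0.
    - by apply: vaddr_ge0; exact: vpos_ge0.
  have fN x : f (- x) = - f x by rewrite /f opprK opprB.
  have fZ a x : 0 < a -> f (a *: x) = a * f x.
    move=> a0; rewrite /f -scalerN !vposZ ?ltW// !phiZ ?mulrBr//; exact: vpos_ge0.
  move=> a x y; rewrite fD; congr (_ + _).
  have [a0|a0|->] := ltgtP a 0; last first.
  - by rewrite !scale0r /f oppr0 subrr.
  - exact: fZ.
  - by rewrite -[a]opprK scaleNr fN fZ ?oppr_gt0// scaleNr.
have fM x : `|f x| <= (`|M| * 2) * `|x|.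
  rewrite -mulrA mulr_natl mulr2n mulrDr (le_trans (ler_normB _ _))//.
  have phiM' y : 0 <=v y -> `|phi y| <= `|M| * `|y|.
    by move=> y0; rewrite (le_trans (phiM _ y0))// ler_wpM2r// ler_norm.
  apply: lerD; (apply: le_trans; first by apply: phiM'; exact: vpos_ge0).
    by rewrite ler_wpM2l// norm_vpos.
  by rewrite ler_wpM2l// -(normrN x) norm_vpos.
exists (Dual (dual_pred_bounded fl fM)) => x x0 /=.
by rewrite -[in LHS](subr0 x) fE//; [rewrite phi0 subr0|exact: vle_refl].
Qed.

End PositiveFunctionals.

(** * Rosenthal's and Phillips' lemmas *)

Section NatSequences.
Implicit Types P : seq nat -> nat -> Prop.

(** Gliding-hump choice: the condition on each index may refer to the whole list of earlier ones. *)
Lemma dependent_subsequence P :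
  (forall s, exists n, (forall i, i \in s -> (i < n)%N) /\ P s n) ->
  exists f : nat -> nat, (forall i j, (i < j)%N -> (f i < f j)%N) /\
    forall i, P [seq f j | j <- iota 0 i] (f i).
Proof.
move=> H; pose g s := projT1 (cid (H s)).
have gP s : (forall i, i \in s -> (i < g s)%N) /\ P s (g s) := projT2 (cid (H s)).
pose L := fix L k := if k is k'.+1 then rcons (L k') (g (L k')) else [::].
have LE k : L k = [seq g (L j) | j <- iota 0 k].
  by elim: k => // k IH; rewrite -addn1 iotaD map_cat -IH addn1 /= add0n cats1.
exists (fun k => g (L k)); split=> [i j ij|i]; last by rewrite -LE; exact: (gP _).2.
apply: (gP _).1; rewrite (LE j); apply/mapP; exists i => //.
by rewrite mem_iota.
Qed.

Lemma strictly_increasing_ge (f : nat -> nat) :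
  (forall i j, (i < j)%N -> (f i < f j)%N) -> forall n, (n <= f n)%N.
Proof.
by move=> fi; elim=> // n IH; apply: leq_ltn_trans IH _; exact: fi.
Qed.

Lemma strictly_increasing_inj (f : nat -> nat) :
  (forall i j, (i < j)%N -> (f i < f j)%N) -> injective f.
Proof.
by move=> fi i j; have [/fi|/fi|//] := ltngtP i j; lia.
Qed.

Lemma injective_unbounded (f : nat -> nat) n : injective f -> exists i, (n <= f i)%N.
Proof.
move=> fi; apply: contrapT => /forallNP H.
have fn i : (f i < n)%N by rewrite ltnNge; apply/negP/H.
have : injective (fun i : 'I_n.+1 => Ordinal (fn i)).
  by move=> i j /(congr1 val)/= /fi/val_inj.
by move/leq_card; rewrite !card_ord ltnn.
Qed.

End NatSequences.

(* Kupka's proof: split the index set into infinitely many infinite pieces. If *)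
(* each piece contains a bad index, the bad indices form an infinite set whose *)
(* masses have dropped by e; this can happen only finitely often.              *)
Lemma rosenthal (R : realType) (nu : nat -> set nat -> R) (C e : R) : 0 < e ->
  (forall n A, 0 <= nu n A) -> (forall n A, nu n A <= C) ->
  (forall n A B, A `&` B = set0 -> nu n A + nu n B <= nu n (A `|` B)) ->
  exists2 f : nat -> nat, injective f &
    forall i, nu (f i) (f @` [set j | j != i]) < e.
Proof.
move=> e0 nu0 nuC nuD.
have nu_le n A B : A `<=` B -> nu n A <= nu n B.
  move=> AB; rewrite -(setDUK AB) -[leLHS]addr0.
  apply: le_trans (nuD _ _ _ _); first by rewrite lerD2l.
  by rewrite setDE setICA setICr setI0.
(* [N] counts the drops by [e] still possible; the bound [C] allows only finitely many. *)
suff H N (f : nat -> nat) : injective f ->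
    (forall i, nu (f i) (range f) <= N%:R * e) ->
    exists2 f : nat -> nat, injective f &
      forall i, nu (f i) (f @` [set j | j != i]) < e.
  apply: (H (Num.truncn (C / e)).+1 id) => // i; apply: le_trans (nuC _ _) _.
  by rewrite -ler_pdivrMr// ltW// truncnS_gt.
elim: N f => [|N IH] f fi fN.
  exists f => // i; apply: le_lt_trans e0; have := fN i; rewrite mul0r.
  by apply: le_trans; apply: nu_le => _ [j _ <-]; exists j.
pose fp (p q : nat) := f (pickle (p, q)).
have pi : injective (@pickle (nat * nat)%type) := pcan_inj pickleK.
have [[p pP]|bad] := pselect (exists p, forall q, nu (fp p q) (fp p @` [set j | j != q]) < e).
  by exists (fp p) => // i j /fi/pi[].
have {}bad p : exists q, e <= nu (fp p q) (fp p @` [set j | j != q]).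
  apply: contrapT => /forallNP Hp; apply: bad; exists p => q.
  by rewrite ltNge; apply/negP/Hp.
pose q p := projT1 (cid (bad p)).
have qP p : e <= nu (fp p (q p)) (fp p @` [set j | j != q p]) := projT2 (cid (bad p)).
apply: (IH (fun p => fp p (q p))) => [i j /fi/pi[]//|p].
have h : range (fun p => fp p (q p)) `&` (fp p @` [set j | j != q p]) = set0.
  rewrite -subset0 => _ [[p' _ <-] [j /= jq /fi/pi[pp jE]]].
  by move: jq; rewrite jE pp eqxx.
have := nuD (fp p (q p)) _ _ h.
have : nu (fp p (q p)) (range (fun p => fp p (q p)) `|` (fp p @` [set j | j != q p])) <= N.+1%:R * e.
  apply: le_trans (fN _); apply: nu_le => _ [[p' _ <-]|[j _ <-]].
    by exists (pickle (p', q p')).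
  by exists (pickle (p, j)).
by have := qP p; rewrite -natr1 mulrDl mul1r; lra.
Qed.

Section LinfIndicator.
Variable R : realType.
Implicit Types (A B : set nat) (a b : linf R).

Fact linf_ind_subproof A : (fun n => (`[< A n >])%:R) \in @linf_pred R.
Proof.
by apply/asboolP; exists 1 => n; case: `[< _ >]; rewrite ?normr1 ?normr0.
Qed.

Definition linf_ind A : linf R := Linf (linf_ind_subproof A).

Lemma linf_indE A n : linf_ind A n = (`[< A n >])%:R. Proof. by []. Qed.

Lemma linfDE a b n : (a + b) n = a n + b n. Proof. by []. Qed.

Lemma linfNE a n : (- a) n = - a n. Proof. by []. Qed.

Lemma linf_norm1P a : `|a| <= 1 <-> forall n, `|a n| <= 1.
Proof.
split=> [a1 n|a1]; last exact: linf_norm_le.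
exact: le_trans (linf_norm_ge a n) a1.
Qed.

Lemma norm_linf_ind A : `|linf_ind A| <= 1.
Proof.
by apply/linf_norm1P => n; rewrite linf_indE; case: `[< _ >]; rewrite ?normr1 ?normr0.
Qed.

Lemma linf_indD1 A n : A n ->
  linf_ind A = linf_ind [set n] + linf_ind (A `\ n).
Proof.
move=> An; apply/val_inj/funext => k.
rewrite -[LHS]/(linf_ind A k) [RHS]linfDE !linf_indE.
have [->|kn] := eqVneq k n.
  by rewrite asboolT// asboolT// asboolF ?addr0// => -[_]; exact.
rewrite (asboolF (P := [set n] k)); last by move=> /eqP; rewrite (negbTE kn).
rewrite add0r; congr (_%:R); congr (nat_of_bool _); apply: asbool_equiv_eq.
by split=> [Ak|[]//]; split=> //; exact/eqP.
Qed.

(** Rosenthal's lemma selects singletons such that each chosen functional has variation below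
    [d / 2] on the other ones. On the indicator of all of them its value then exceeds [d / 2],
    against pointwise convergence. *)
Lemma phillips (m : nat -> dual (linf R)) (f : nat -> nat) (C d : R) : 0 < d ->
  injective f -> (forall n, `|m n| <= C) ->
  (forall a, m n a @[n --> \oo] --> (0 : R)) ->
  ~ forall n, d <= `|m n (linf_ind [set f n])|.
Proof.
move=> d0 fi mC m0 dm.
(* The variation of [m n] on the image of [A] under [f]; it is superadditive because [f] is
   injective, so unit vectors over disjoint index sets add up to a unit ball element. *)
pose nu n A := sup [set m n a | a in [set a : linf R | `|a| <= 1 /\
  forall k, ~ (f @` A) k -> a k = 0]].
have mb n a : `|a| <= 1 -> `|m n a| <= C.
  move=> a1; rewrite (le_trans (dual_ler _ _))//.
  by rewrite -[C]mulr1 ler_pM.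
have hs n A : has_sup [set m n a | a in [set a : linf R | `|a| <= 1 /\
    forall k, ~ (f @` A) k -> a k = 0]].
  split; first by exists (m n 0), 0 => //=; rewrite normr0.
  by exists C => _ [a [a1 _] <-]; rewrite (le_trans (ler_norm _))// mb.
have nu_ge n A a : `|a| <= 1 -> (forall k, ~ (f @` A) k -> a k = 0) -> m n a <= nu n A.
  by move=> a1 aA; apply: (ub_le_sup (hs n A).2); exists a.
have nu_le n A c : (forall a, `|a| <= 1 -> (forall k, ~ (f @` A) k -> a k = 0) -> m n a <= c) -> nu n A <= c.
  by move=> H; apply: (ge_sup (hs n A).1) => _ [a [a1 aA] <-]; exact: H.
have [|||h hi hd] := @rosenthal R nu C (d / 2) (divr_gt0 d0 (ltr0n _ 2)).
- by move=> n A; rewrite -[0](linear0 (m n)); apply: nu_ge => //; rewrite normr0.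
- by move=> n A; apply: (nu_le) => a a1 _; rewrite (le_trans (ler_norm _))// mb.
- move=> n A B AB0; rewrite -lerBrDr; apply: (nu_le) => a a1 aA; rewrite lerBrDl -lerBrDr.
  apply: (nu_le) => b b1 bB; rewrite lerBrDl -linearD; apply: nu_ge.
    apply/linf_norm1P => k; rewrite linfDE.
    have [Ak|Ak] := pselect ((f @` A) k).
      rewrite (bB k) ?addr0; first exact: (linf_norm1P a).1.
      move: Ak => [i Ai <-] [j Bj /fi ji]; have : (A `&` B) i by split; rewrite // -ji.
      by rewrite AB0.
    by rewrite (aA k)// add0r; exact: (linf_norm1P b).1.
  by move=> k kAB; rewrite linfDE aA ?bB ?addr0//; apply: contra_not kAB => -[i Ai <-]; exists i => //; [right|left].
pose M := f @` range h.
have /cvgr0_norm_lt/(_ (d / 2) (divr_gt0 d0 (ltr0n _ 2)))[N _ NP] := m0 (linf_ind M).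
have [i /NP/=] := injective_unbounded N hi.
have -> : linf_ind M = linf_ind [set f (h i)] + linf_ind (M `\ f (h i)).
  by apply: linf_indD1; exists (h i) => //; exists i.
have MA k : ~ (f @` (h @` [set j | j != i])) k -> linf_ind (M `\ f (h i)) k = 0.
  rewrite linf_indE => nk; rewrite asboolF// => -[[_ [j _ <-] jk] ki].
  apply: nk; exists (h j) => //; exists j => //=; apply/eqP => ji.
  by apply: ki; rewrite -jk ji.
have MA' k : ~ (f @` (h @` [set j | j != i])) k -> (- linf_ind (M `\ f (h i))) k = 0.
  by move=> /MA; rewrite linfNE => ->; rewrite oppr0.
have y1 := nu_ge (h i) _ _ (norm_linf_ind _) MA.
have y2 := nu_ge (h i) _ (- linf_ind (M `\ f (h i))) _ MA'.
rewrite normrN linearN/= in y2; have {}y2 := y2 (norm_linf_ind _).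
have := hd i; have := dm (h i); rewrite linearD/=.
set y := m _ _ in y1 y2 *; set x := m _ _; set z := nu _ _ in y1 y2 *.
move=> dx zd xy; have yz : `|y| <= z by rewrite ler_norml; lra.
have := ler_normB (x + y) y; rewrite addrK; lra.
Qed.

End LinfIndicator.

(** * A Khinchine inequality *)

Section Khinchine.
Variables (R : realType) (F : banachLatticeType R).
Implicit Types (u v : F) (s : seq F).

(** The sum of the moduli of [v] plus all signed sums of [s], as a recursion so that signs can be
    split off one at a time. *)
Fixpoint sign_sum s v : F :=
  if s is u :: s' then sign_sum s' (v + u) + sign_sum s' (v - u) else vabs v.

Lemma scale_sign_split (p q : R) u v :
  (q + p) *: (v + u) + (q - p) *: (v - u) = (2 * q) *: v + (2 * p) *: u.
Proof.
rewrite !mulr_natl !mulr2n scalerDr scalerBr !scalerDl !scaleNr opprB.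
by rewrite addrACA [X in X + _]addrACA subrr addr0 [X in _ + (X + _)]addrC
  [X in _ + X]addrACA subrr addr0.
Qed.

(* Induction on s, pairing the signs with the Riesz product                    *)
(* Im ((p + i q) prod (1 + i a e_k)), of modulus at most r b ^ size s.          *)
Lemma riesz_product (a b : R) s v (p q r : R) :
  0 <= a -> 0 <= b -> 1 + a ^+ 2 <= b ^+ 2 ->
  0 <= r -> p ^+ 2 + q ^+ 2 <= r ^+ 2 ->
  (2 ^+ size s * q) *: v + (2 ^+ size s * (a * `|p|)) *: (\sum_(u <- s) vabs u)
    <=v (r * b ^+ size s) *: sign_sum s v.
Proof.
move=> a0 b0 ab; elim: s v p q r => [|u s IH] v p q r r0 pqr.
  rewrite big_nil scaler0 addr0 /= !expr0 mul1r mulr1.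
  apply: vle_trans (vle_scale_abs q v) _; apply: vle_scalel; last exact: vabs_ge0.
  rewrite -(ger0_norm r0) -ler_sqr ?nnegrE// !real_normK ?num_real//.
  by apply: le_trans pqr; rewrite lerDr sqr_ge0.
rewrite big_cons /= !exprS; set n := size s; set S := \sum_(_ <- _) _.
have S0 : 0 <=v S by apply: vsum_ge0 => w _; exact: vabs_ge0.
set Y := (r * (b * b ^+ n)) *: _.
pose X := (2 * 2 ^+ n * q) *: v + (2 * 2 ^+ n * (a * `|p|)) *: S.
have e c : 2 * 2 ^+ n * c = 2 ^+ n * (2 * c) :> R by rewrite -mulrA mulrCA.
(* The two values of [t] give both signs of the multiple of [u], hence its modulus. *)
have key t : t = p \/ t = - p -> X + (2 * 2 ^+ n * (a * t)) *: u <=v Y.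
  move=> tp.
  have t2 : t ^+ 2 = p ^+ 2 by case: tp => ->; rewrite ?sqrrN.
  have tn : `|t| = `|p| by case: tp => ->; rewrite ?normrN.
  have rb : 0 <= r * b by rewrite mulr_ge0.
  have h c d : (c ^+ 2 + d ^+ 2 = (1 + a ^+ 2) * (p ^+ 2 + q ^+ 2)) -> c ^+ 2 + d ^+ 2 <= (r * b) ^+ 2.
    move=> ->; rewrite exprMn mulrC ler_pM// ?addr_ge0 ?sqr_ge0//.
  (* The new parameters are the real and imaginary parts of (t + i q)(1 + i a) here and of (t + i
     q)(1 - i a) below. *)
  have h1 := IH (v + u) (t - a * q) (q + a * t) _ rb (h _ _ _).
  have h2 := IH (v - u) (t + a * q) (q - a * t) _ rb (h _ _ _).
  have := vleD (h1 _) (h2 _).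
  rewrite -scalerDr -mulrA => H; apply: vle_trans (H _ _); last 2 first.
  - by rewrite -t2; ring.
  - by rewrite -t2; ring.
  rewrite addrACA -!scalerA -scalerDr scale_sign_split scalerDr !scalerA.
  rewrite /X addrAC; apply: vleD.
    rewrite !e -!mulrA; exact: vle_refl.
  rewrite -!scalerDl -!mulrDr; apply: vle_scalel => //.
  rewrite -tn [2 * _]mulrC -!mulrA ler_wpM2l ?exprn_ge0// mulrCA ler_wpM2l//.
  rewrite mulr_natl mulr2n; have := ler_normD (t - a * q) (t + a * q).
  by rewrite addrACA addNr addr0 -mulr2n normrMn mulr2n.
rewrite scalerDr addrCA.
have -> : (2 * 2 ^+ n * (a * `|p|)) *: vabs u = vabs ((2 * 2 ^+ n * (a * p)) *: u).
  rewrite vabsZ !normrM (ger0_norm a0) (ger0_norm (exprn_ge0 _ _))//.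
  by rewrite ger0_norm.
have {}key : vabs ((2 * 2 ^+ n * (a * p)) *: u) <=v Y - X.
  apply: vle_sup; apply/vsubr_ge0; rewrite -addrA -opprD; apply/vsubr_ge0.
    by apply: key; left.
  by rewrite -scaleNr -!mulrN; apply: key; right.
rewrite addrC; move: key => /(vle_add2r X); rewrite subrK; congr vle.
by rewrite addrC /X addrA.
Qed.

Lemma bernoulli_le (x : R) n : 0 <= x -> x <= 1 -> 1 - n%:R * x <= (1 - x) ^+ n.
Proof.
move=> x0 x1; elim: n => [|n IH]; first by rewrite mul0r subr0.
rewrite exprS -natr1; have nx : 0 <= n%:R * x by rewrite mulr_ge0.
apply: le_trans (_ : (1 - x) * (1 - n%:R * x) <= _); first by nra.
by rewrite ler_wpM2l// subr_ge0.
Qed.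

(** With x = 1 / (2 (n + 1)), Bernoulli bounds the power of 1 - x below by 1/2, and (1 + x)(1 - x)
    is at most 1. This keeps the Riesz product bounded independently of its length. *)
Lemma expr1_half_inv_le2 n : (1 + (2 * n.+1%:R)^-1) ^+ n.+1 <= 2 :> R.
Proof.
set x := (2 * n.+1%:R)^-1.
have n0 : 0 < 2 * n.+1%:R :> R by rewrite mulr_gt0.
have x0 : 0 <= x by rewrite invr_ge0 ltW.
have nx : n.+1%:R * x = 2^-1 by rewrite /x invfM mulrCA mulfV ?mulr1 ?pnatr_eq0.
have x1 : x <= 2^-1 by rewrite -nx ler_peMl// ler1n.
have := bernoulli_le n.+1 x0 (le_trans x1 _); rewrite nx => h.
have {}h : 2^-1 <= (1 - x) ^+ n.+1 by have := h ltac:(lra); lra.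
have h1 : (1 + x) ^+ n.+1 * (1 - x) ^+ n.+1 <= 1.
  by rewrite -exprMn exprn_ile1//; nra.
have : 0 <= (1 + x) ^+ n.+1 by rewrite exprn_ge0// addr_ge0.
nra.
Qed.

End Khinchine.

(** * Order bounded series *)

Section OrderContinuity.
Variables (R : realType) (F : banachLatticeType R).
Implicit Types (x u v : F) (y : nat -> F) (f g h : dual F).

(** Its negation is used in the role of order continuity of the norm. *)
Definition separated_order_bounded_series := exists (y : nat -> F) (b : F) (d : R),
  [/\ 0 < d, forall n, 0 <=v y n, forall n, d <= `|y n| &
      forall n, \sum_(k < n) y k <=v b].

(** If the sequence is not Cauchy, increments over successive blocks have norms bounded below, and
    their sums telescope. *)
Lemma increasing_bounded_cvg (x : nat -> F) b :
  ~ separated_order_bounded_series -> (forall n, x n <=v x n.+1) ->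
  (forall n, x n <=v b) -> cvgn x.
Proof.
move=> ns xi xb; have xm i j : (i <= j)%N -> x i <=v x j.
  move=> /subnK <-; elim: (j - i)%N => [|k IH]; first exact: vle_refl.
  exact: vle_trans IH (xi _).
apply: cauchy_cvg; apply: cauchy_exP => e e0; apply: contrapT => /forallNP ne.
have {}ne N : exists n, (N <= n)%N /\ e <= `|x n - x N|.
  apply: contrapT => /forallNP nN; apply: (ne (x N)); exists N => // n Nn.
  rewrite -ball_normE /= distrC ltNge; apply/negP => en.
  by apply: (nN n).
pose g N := projT1 (cid (ne N)).
have gP N : (N <= g N)%N /\ e <= `|x (g N) - x N| := projT2 (cid (ne N)).
pose y n := x (iter n.+1 g 0) - x (iter n g 0).
apply: ns; exists y, (b - x 0), e; split=> //.
- by move=> n; apply/vsubr_ge0; apply: xm => /=; exact: (gP _).1.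
- by move=> n; exact: (gP _).2.
- move=> n; suff -> : \sum_(k < n) y k = x (iter n g 0) - x 0 by exact: vle_add2r.
  elim: n => [|n IH]; first by rewrite big_ord0 subrr.
  by rewrite big_ord_recr/= IH /y addrC addrA subrK.
Qed.

Lemma dual_sup_le f u v : 0 <=v f -> 0 <=v u -> 0 <=v v -> f (vsup u v) <= f u + f v.
Proof.
move=> f0 u0 v0; rewrite -linearD; apply: dual_le => //; apply: vle_sup.
  by rewrite -[X in X <=v _]addr0; exact: vle_add2l.
by rewrite -[X in X <=v _]add0r; exact: vle_add2r.
Qed.

Lemma dual_le_of_norm f x : `|f| <= 1 -> f x <= `|x|.
Proof.
move=> f1; apply: le_trans (ler_norm _) _; apply: le_trans (dual_ler _ _) _.
by rewrite ler_piMl.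
Qed.

Fixpoint sup_from (y : nat -> F) n N : F :=
  if N is N'.+1 then vsup (y n) (sup_from y n.+1 N') else 0.

Lemma sup_from_ge0 y n N : (forall n, 0 <=v y n) -> 0 <=v sup_from y n N.
Proof.
move=> y0; case: N => [|N] /=; first exact: vle_refl.
exact: vle_trans (y0 n) (vle_supl _ _).
Qed.

Lemma sup_from_le y n N x : 0 <=v x -> (forall n, y n <=v x) -> sup_from y n N <=v x.
Proof. by move=> x0 yx; elim: N n => //= N IH n; apply: vle_sup. Qed.

Lemma sup_from_incr y n N : (forall n, 0 <=v y n) ->
  sup_from y n N <=v sup_from y n N.+1.
Proof.
move=> y0; elim: N n => [|N IH] n; first exact: sup_from_ge0.
apply: vle_sup; first exact: vle_supl.
exact: vle_trans (IH n.+1) (vle_supr _ _).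
Qed.

Lemma dual_sup_from_le y n N f c : 0 <=v f -> 0 <= c -> (forall n, 0 <=v y n) ->
  (forall k, (n <= k)%N -> f (y k) <= c * 2^-1 ^+ k) ->
  f (sup_from y n N) <= c * (2 * 2^-1 ^+ n).
Proof.
move=> f0 c0 y0; elim: N n => [|N IH] n fy /=.
  by rewrite linear0 !mulr_ge0// exprn_ge0// invr_ge0.
apply: le_trans (dual_sup_le f0 (y0 n) (sup_from_ge0 n.+1 N y0)) _.
have := fy n (leqnn n); have := IH n.+1 (fun k nk => fy k (ltnW nk)).
rewrite exprS; set t := 2^-1 ^+ n; set a := f _; set d := f _ => h1 h2.
have -> : c * (2 * t) = c * t + c * (2 * (2^-1 * t)) by field.
exact: lerD.
Qed.

(* With s_n = sup_{k >= n} y_k, the decreasing order bounded sequence s_n      *)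
(* converges, and f_n (s_n - s_{n+1}) is at least f_n (y_n) - f_n (s_{n+1}).   *)
Lemma almost_disjoint_null (y : nat -> F) (f : nat -> dual F) (x : F) c :
  ~ separated_order_bounded_series -> 0 <= c ->
  (forall n, 0 <=v f n) -> (forall n, `|f n| <= 1) ->
  (forall n, 0 <=v y n) -> (forall n, y n <=v x) ->
  (forall n k, (n < k)%N -> f n (y k) <= c * 2^-1 ^+ k) ->
  f n (y n) @[n --> \oo] --> (0 : R).
Proof.
move=> ns c0 f0 f1 y0 yx fy.
have x0 : 0 <=v x := vle_trans (y0 0) (yx 0).
have cv n : cvgn (sup_from y n).
  apply: (@increasing_bounded_cvg _ x) => // N; first exact: sup_from_incr.
  exact: sup_from_le.
pose s n := limn (sup_from y n).
have ssE n : sup_from y n N.+1 @[N --> \oo] --> s n by rewrite cvg_shiftS; exact: cv.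
have sy n : y n <=v s n.
  by apply: (vle_cvg _ (cvg_cst (y n)) (ssE n)) => N; exact: vle_supl.
have ss n : s n.+1 <=v s n.
  by apply: (vle_cvg _ (cv n.+1) (ssE n)) => N; exact: vle_supr.
have sx n : s n <=v x.
  by apply: (vle_cvg _ (cv n) (cvg_cst x)) => N; exact: sup_from_le.
have s0 n : 0 <=v s n := vle_trans (y0 n) (sy n).
have cs : cvgn (fun n => - s n).
  apply: (@increasing_bounded_cvg _ 0) => // n; first exact: vleN.
  exact: voppr_le0.
have dn : `|s n - s n.+1| @[n --> \oo] --> (0 : R).
  rewrite -[X in _ --> X](@normr0 _ F); apply: cvg_norm.
  have /cvg_ex[l sl] : cvgn s by rewrite -[s]opprK; exact: is_cvgN.
  by rewrite -(subrr l); apply: cvgB => //; rewrite cvg_shiftS.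
have fs n : f n (s n.+1) <= c * (2 * 2^-1 ^+ n.+1).
  apply: (cvgr_to_le (dual_cvg (f := f n) (cv n.+1))).
  by near=> N; apply: dual_sup_from_le => // k; exact: fy.
have h n : 0 <= f n (y n) <= `|s n - s n.+1| + c * 2^-1 ^+ n.
  rewrite dual_ge0//=; have := dual_le (f0 n) (sy n).
  have := dual_le_of_norm (s n - s n.+1) (f1 n); rewrite linearB/=.
  have e : 2 * 2^-1 ^+ n.+1 = 2^-1 ^+ n :> R by rewrite exprS mulrA mulfV ?mul1r ?pnatr_eq0.
  by have := fs n; rewrite e; lra.
apply: (squeeze_cvgr (f := fun=> 0) (h := fun n => `|s n - s n.+1| + c * 2^-1 ^+ n)).
- by near=> n; exact: h.
- exact: cvg_cst.
- rewrite -[X in _ --> X](addr0 0); apply: cvgD => //.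
  rewrite -[X in _ --> X](mulr0 c); apply: cvgM; first exact: cvg_cst.
  by apply: cvg_expr; rewrite ger0_norm ?invr_ge0// invf_lt1// ltr1n.
Unshelve. all: by end_near. Qed.

(* On the positive cone this is the part of f_n that is almost disjoint from    *)
(* f_0, ..., f_(n-1): a y almost attaining it satisfies f_k (y) = O (2 ^ - n)   *)
(* for k < n.                                                                   *)
Definition disjointified (f : nat -> dual F) n : dual F :=
  vpos (f n - 2 ^+ n *: \sum_(k < n) f k).

Lemma dposE_vpos f x : 0 <=v x -> vpos f x = dposc f x.
Proof.
by move=> x0; rewrite -[vpos f]/(dsup f 0) dsupE// subr0 add0r.
Qed.

Lemma dual_sumE (I : Type) (s : seq I) (P : pred I) (f : I -> dual F) x :
  (\sum_(i <- s | P i) f i) x = \sum_(i <- s | P i) f i x.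
Proof. by elim/big_rec2: _ => // i y1 y2 _ <-. Qed.

(** Choose y_n in [0, x] attaining the Riesz-Kantorovich supremum up to 2^-n. As that supremum is
    nonnegative, 2^n times the sum of the earlier f_k (y_n) is at most [|x| + 1], so
    [almost_disjoint_null] applies. *)
Lemma disjointified_null (f : nat -> dual F) x :
  ~ separated_order_bounded_series ->
  (forall n, 0 <=v f n) -> (forall n, `|f n| <= 1) -> 0 <=v x ->
  disjointified f n x @[n --> \oo] --> (0 : R).
Proof.
move=> ns f0 f1 x0; pose t n := f n - 2 ^+ n *: \sum_(k < n) f k.
have tn n : exists y : F, [/\ 0 <=v y, y <=v x & disjointified f n x - 2^-1 ^+ n <= t n y].
  have e0 : 0 < (2^-1 : R) ^+ n by rewrite exprn_gt0// invr_gt0.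
  have [_ [y [y0 yx] <-]] := sup_adherent e0 (dposc_has_sup (t n) x0).
  by rewrite -[sup _]/(dposc _ _) -dposE_vpos// => /ltW ?; exists y.
pose y n := projT1 (cid (tn n)).
have yP n : [/\ 0 <=v y n, y n <=v x & disjointified f n x - 2^-1 ^+ n <= t n (y n)].
  exact: projT2 (cid (tn n)).
have y0 n : 0 <=v y n by have [] := yP n.
have yx n : y n <=v x by have [] := yP n.
have hx n : 0 <= disjointified f n x by apply: dual_ge0 => //; exact: vpos_ge0.
have tE n : t n (y n) = f n (y n) - 2 ^+ n * \sum_(k < n) f k (y n).
  by rewrite /t dualDE dualNE dualZE dual_sumE.
have sum0 n : 0 <= \sum_(k < n) f k (y n) by apply: sumr_ge0 => k _; exact: dual_ge0.
have fx n : f n (y n) <= `|x|.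
  by apply: le_trans (dual_le_of_norm _ (f1 n)) _; exact: vle_norm0.
have p1 n : (2^-1 : R) ^+ n <= 1 by rewrite exprn_ile1// ?invr_ge0// invf_le1// ler1n.
have fy n k : (n < k)%N -> f n (y k) <= (`|x| + 1) * 2^-1 ^+ k.
  move=> nk; have [_ _] := yP k; rewrite tE => h.
  have le_sum : f n (y k) <= \sum_(j < k) f j (y k).
    rewrite (bigD1 (Ordinal nk))//= lerDl; apply: sumr_ge0 => j _; exact: dual_ge0.
  rewrite exprVn -[_ / _]/(_ * _) ler_pdivlMr ?exprn_gt0// mulrC.
  apply: le_trans (_ : 2 ^+ k * \sum_(j < k) f j (y k) <= _).
    by rewrite ler_wpM2l// exprn_ge0.
  by have := hx k; have := fx k; have := p1 k; lra.
have c0 : 0 <= `|x| + 1 by rewrite addr_ge0.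
have := almost_disjoint_null ns c0 f0 f1 y0 yx fy => fyn.
apply: (squeeze_cvgr (f := fun=> 0) (h := fun n => f n (y n) + 2^-1 ^+ n)).
- near=> n; apply/andP; split; first exact: hx.
  have [_ _] := yP n; rewrite tE.
  have : 0 <= 2 ^+ n * \sum_(k < n) f k (y n) by rewrite mulr_ge0// exprn_ge0.
  by lra.
- exact: cvg_cst.
- rewrite -[X in _ --> X](addr0 0); apply: cvgD => //.
  by apply: cvg_expr; rewrite ger0_norm ?invr_ge0// invf_lt1// ltr1n.
Unshelve. all: by end_near. Qed.

End OrderContinuity.

(** * Copies of l_infinity *)

Section LinfCopies.
Variables (R : realType) (F : banachLatticeType R).
Implicit Types (phi : dual F).

Lemma linear_continuous_bounded (V W : normedModType R) (T : {linear V -> W}) :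
  continuous T -> exists2 C, 0 <= C & forall a, `|T a| <= C * `|a|.
Proof.
move=> /linear_bounded_continuous/linear_boundedP [M [Mr /(_ (M + 1))]].
rewrite ltrDl ltr01 => /(_ isT) TM; exists `|M + 1| => // a.
by apply: le_trans (TM a) _; rewrite ler_wpM2r// ler_norm.
Qed.

Variables (T : {linear linf R -> F}) (C : R).
Hypotheses (C0 : 0 <= C) (TC : forall a, `|T a| <= C * `|a|).
Let e n : linf R := linf_ind R [set n].

(** Adding signed unit vectors outside the support of [a] keeps the supremum norm at most 1, so each
    of the 2 ^ (size s) terms is bounded by [|phi| * C]. *)
Lemma sign_sum_bound phi (s : seq nat) (a : linf R) : uniq s ->
  (forall n, n \in s -> a n = 0) -> `|a| <= 1 ->
  phi (sign_sum [seq T (e n) | n <- s] (T a)) <= 2 ^+ size s * (`|phi| * C).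
Proof.
elim: s a => [|k s IH] a /=.
  move=> _ _ a1; rewrite expr0 mul1r (le_trans (ler_norm _))//.
  rewrite (le_trans (dual_ler _ _))// ler_wpM2l// norm_vabs (le_trans (TC a))//.
  by rewrite ler_piMr.
move=> /andP[ks us] a0 a1; rewrite linearD exprS -mulrA mulr_natl mulr2n.
have ek n : n != k -> e k n = 0.
  by move=> nk; rewrite linf_indE asboolF// => /eqP; rewrite (negbTE nk).
have ekk : e k k = 1 by rewrite linf_indE asboolT.
have ak := a0 k (mem_head _ _).
have sn n : n \in s -> n != k by apply: contraTneq => ->.
rewrite -[T a + _]linearD -[T a - _]linearB; apply: lerD; apply: IH => //.
- by move=> n ns; rewrite linfDE ek ?sn// a0 ?addr0// inE ns orbT.
- apply/linf_norm1P => n; rewrite linfDE; have [->|nk] := eqVneq n k.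
    by rewrite ak ekk add0r normr1.
  by rewrite ek// addr0; exact: (linf_norm1P a).1.
- by move=> n ns; rewrite linfDE linfNE ek ?sn// a0 ?subr0// inE ns orbT.
- apply/linf_norm1P => n; rewrite linfDE linfNE; have [->|nk] := eqVneq n k.
    by rewrite ak ekk add0r normrN normr1.
  by rewrite ek// subr0; exact: (linf_norm1P a).1.
Qed.

(** A Khinchine estimate: a sum of N terms grows at most like the square root of N; N is taken to be
    a square. *)
Lemma sum_vabs_le phi (s : seq nat) k : 0 <=v phi -> uniq s ->
  size s = (k.+1 ^ 2)%N ->
  \sum_(n <- s) phi (vabs (T (e n))) <= 2 * k.+1%:R * (`|phi| * C).
Proof.
move=> phi0 us sk; set N := (k.+1 ^ 2)%N in sk.
have N1 : N = N.-1.+1 by rewrite prednK// expn_gt0.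
(* With a^2 = 1/N and b = 1 + 1/(2N), both 1 + a^2 <= b^2 and b^N <= 2 hold. *)
pose a : R := k.+1%:R^-1; pose b : R := 1 + (2 * N%:R)^-1.
have b2 : b ^+ N <= 2 by rewrite /b N1; exact: expr1_half_inv_le2.
have a0 : 0 <= a by rewrite invr_ge0.
have b0 : 0 <= b by rewrite addr_ge0 ?invr_ge0 ?mulr_ge0.
have ab : 1 + a ^+ 2 <= b ^+ 2.
  have xE : (2 * N%:R : R)^-1 *+ 2 = a ^+ 2.
    by rewrite /a exprVn -natrX -[LHS]mulr_natl invfM mulrA mulfV ?mul1r ?pnatr_eq0.
  by rewrite sqrrD expr1n mul1r xE lerDl sqr_ge0.
have := @riesz_product R F a b [seq T (e n) | n <- s] (T 0) 1 0 1 a0 b0 ab ler01.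
rewrite expr1n expr0n addr0 => /(_ (lexx _)); rewrite mulr0 scale0r add0r.
rewrite size_map sk normr1 mulr1 mul1r big_map => /(dual_le phi0).
rewrite !linearZ/= linear_sum/= => h.
have := @sign_sum_bound phi s 0 us (fun _ _ => erefl); rewrite normr0 sk => /(_ ler01).
set S := \sum_(_ <- _) _ in h *; set M := phi _ in h *; set t := 2 ^+ N in h * => h1.
have t0 : 0 < t by rewrite exprn_gt0.
have K0 : 0 <= `|phi| * C by rewrite mulr_ge0.
have : t * (a * S) <= t * (2 * (`|phi| * C)).
  rewrite mulrA (le_trans h)// (le_trans (_ : b ^+ N * M <= b ^+ N * (t * (`|phi| * C))))//.
    by rewrite ler_wpM2l// exprn_ge0.
  by rewrite mulrCA ler_pM2l// ler_wpM2r.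
by rewrite ler_pM2l// /a ler_pdivrMl// mulrCA mulrA.
Qed.

(** Otherwise N terms of size at least [d] would sum to at least N d, which outgrows the square root
    bound of [sum_vabs_le]. *)
Lemma functional_vabs_null phi (d : R) : 0 <=v phi -> 0 < d ->
  exists N, forall n, (N <= n)%N -> phi (vabs (T (e n))) < d.
Proof.
move=> phi0 d0; apply: contrapT => /forallNP H.
have [f [fi fP]] : exists f : nat -> nat, (forall i j, (i < j)%N -> (f i < f j)%N) /\
    forall i, d <= phi (vabs (T (e (f i)))).
  have [s|f [fi fP]] := @dependent_subsequence (fun s n => d <= phi (vabs (T (e n)))).
    have /existsNP[n /not_implyP[sn /negP]] := H (\max_(i <- s) i).+1.
    rewrite -leNgt => dn; exists n; split=> // i is_; apply: leq_ltn_trans sn.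
    exact: leq_bigmax_seq.
  by exists f.
pose k := Num.truncn (2 * (`|phi| * C) / d).
pose s := [seq f i | i <- iota 0 (k.+1 ^ 2)].
have us : uniq s by rewrite map_inj_uniq ?iota_uniq//; exact: strictly_increasing_inj.
have := @sum_vabs_le phi s k phi0 us; rewrite size_map size_iota => /(_ erefl).
apply/negP; rewrite -ltNge; apply: lt_le_trans (_ : (k.+1 ^ 2)%:R * d <= _).
  rewrite natrX expr2 [2 * _]mulrC -!mulrA ltr_pM2l// mulrA -ltr_pdivrMr//.
  by rewrite -mulrA; exact: truncnS_gt.
rewrite big_map -[X in X%:R * _](size_iota 0) -sum1_size natr_sum mulr_suml.
by apply: ler_sum => i _; rewrite mul1r.
Qed.

Lemma linf_copy_separated_series (d : R) : 0 < d -> (forall n, d <= `|T (e n)|) ->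
  separated_order_bounded_series F.
Proof.
move=> d0 dT; apply: contrapT => ns.
pose u n := T (e n).
pose f n : dual F := projT1 (cid (positive_norming (u n))).
have fP n : [/\ 0 <=v f n, `|f n| <= 1 & f n (vabs (u n)) = `|u n|].
  exact: projT2 (cid (positive_norming (u n))).
(* The weight [2 ^+ size s] matches the factor [2 ^+ n] in [disjointified], so the subtraction made
   there costs at most [d / 2]. *)
have [s|j [ji jP]] := @dependent_subsequence (fun s n =>
  2 ^+ size s * (\sum_(k <- s) f k) (vabs (u n)) <= d / 2).
  have phi0 : 0 <=v \sum_(k <- s) f k by apply: vsum_ge0 => k _; case: (fP k).
  have c0 : 0 < d / 2 / 2 ^+ size s by rewrite !divr_gt0// exprn_gt0.
  have [N NP] := functional_vabs_null phi0 c0.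
  exists (maxn N (\max_(i <- s) i).+1); split=> [i is_|].
    by rewrite leq_max ltnS (leq_bigmax_seq (F := id))// orbT.
  by rewrite mulrC -ler_pdivlMr ?exprn_gt0// ltW// NP// leq_maxl.
pose h := disjointified (f \o j).
have f0 n : 0 <=v (f \o j) n by case: (fP (j n)).
have f1 n : `|(f \o j) n| <= 1 by case: (fP (j n)).
have h0 x : 0 <=v x -> h n x @[n --> \oo] --> (0 : R).
  exact: disjointified_null.
have hpos n : 0 <=v h n by exact: vpos_ge0.
have hle n : h n <=v f (j n).
  apply: vle_sup; last exact: f0.
  apply/vlerBl; rewrite -[X in X <=v _]addr0; apply: vle_add2l.
  by apply: vle_scale_ge0; [exact: exprn_ge0|apply: vsum_ge0 => k _; exact: f0].
have hu n : d / 2 <= h n (vabs (u (j n))).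
  have /(_ _ (vabs_ge0 (u (j n)))) : f (j n) - 2 ^+ n *: \sum_(k < n) f (j k) <=v h n by exact: vle_pos.
  have [_ _] := fP (j n); rewrite dualDE dualNE dualZE => ->.
  have := jP n; rewrite size_map size_iota big_map.
  rewrite (_ : iota 0 n = index_iota 0 n); last by rewrite /index_iota subn0.
  rewrite big_mkord.
  by have := dT (j n); rewrite -/(u _); lra.
(* Phillips' lemma needs values at [u (j n)] rather than at its modulus: its positive or its
   negative part carries at least [d / 4], and some functional between 0 and [h n] attains that
   value at [u (j n)] up to sign. *)
have hg n : exists g, [/\ 0 <=v g, g <=v h n & d / 4 <= `|g (u (j n))|].
  have [hp|hp] := leP (d / 4) (h n (vpos (u (j n)))).
    have [g [g0 gh gu]] := positive_part_attained (u (j n)) (hpos n).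
    by exists g; split=> //; rewrite gu (le_trans hp)// ler_norm.
  have [g [g0 gh gu]] := positive_part_attained (- u (j n)) (hpos n).
  exists g; split=> //; have -> : `|g (u (j n))| = `|g (- u (j n))| by rewrite linearN normrN.
  rewrite gu (le_trans _ (ler_norm _))//.
  have := hu n; rewrite vabsE.
  have -> : h n (vpos (u (j n)) + vpos (- u (j n))) = h n (vpos (u (j n))) + h n (vpos (- u (j n))) by exact: linearD.
  by lra.
pose g n := projT1 (cid (hg n)).
have gP n : [/\ 0 <=v g n, g n <=v h n & d / 4 <= `|g n (u (j n))|] := projT2 (cid (hg n)).
have gnull x : g n x @[n --> \oo] --> (0 : R).
  have pos y : 0 <=v y -> g n y @[n --> \oo] --> (0 : R).
    move=> y0; apply: (squeeze_cvgr (f := fun=> 0) (h := fun n => h n y)).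
    - by near=> n; have [g0 gh _] := gP n; rewrite dual_ge0//=; exact: gh.
    - exact: cvg_cst.
    - exact: h0.
  have -> : (fun n => g n x) = (fun n => g n (vpos x) - g n (vpos (- x))).
    by apply/funext => n; rewrite -linearB vposN subKr.
  by rewrite -[X in _ --> X](subr0 0); apply: cvgB; apply: pos; exact: vpos_ge0.
have gTd n : (g n \o T) \in @dual_pred R (linf R).
  apply: (dual_pred_bounded (M := `|g n| * C)) => [a x y|a] /=.
    by rewrite !linearP.
  by rewrite -mulrA (le_trans (dual_ler _ _))// ler_wpM2l.
apply: (@phillips R (fun n => Dual (gTd n)) j C (d / 4)) => //.
- by rewrite divr_gt0.
- exact: strictly_increasing_inj.
- move=> n; apply: dual_norm_ub => // a /=; have [g0 gh _] := gP n.
  rewrite (le_trans (dual_ler _ _))// (le_trans (_ : _ <= 1 * `|T a|))//.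
    rewrite ler_wpM2r// (le_trans _ (f1 n))//; apply: vle_norm0 => //.
    exact: vle_trans gh (hle n).
  by rewrite mul1r.
- by move=> a /=; exact: gnull.
- by move=> n; have [] := gP n.
Unshelve. all: by end_near. Qed.

End LinfCopies.

(** Continuity of the inverse at 0 keeps the images of the unit vectors away from 0. *)
Lemma contains_linf_separated_series (R : realType) (F : banachLatticeType R) :
  contains_copy (linf R) F -> separated_order_bounded_series F.
Proof.
move=> [T [S [_ cT TS cS]]].
have [C C0 TC] := linear_continuous_bounded cT.
have S0 : S 0 = 0 by rewrite -(linear0 T) TS.
have /subspace_continuousP/(_ 0) := cS.
have r0 : range T 0 by exists 0 => //; rewrite linear0.
move=> /(_ r0)/cvgrPdist_lt/(_ 1 ltr01); rewrite /prop_near1 nbhs_simpl /= /within/= => /nbhs_ballP[d /= d0 dP].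
apply: (linf_copy_separated_series C0 TC d0) => n.
rewrite leNgt; apply/negP => Td.
have := dP (T (linf_ind R [set n])); rewrite -ball_normE/= sub0r normrN => /(_ Td).
rewrite /from_subspace TS S0 sub0r normrN => /(_ (ex_intro2 _ _ _ I erefl)).
apply/negP; rewrite -leNgt; apply: le_trans (linf_norm_ge _ n).
by rewrite linf_indE asboolT// normr1.
Qed.

(** * Weakly null sequences and the positive Schur property *)

Section WeaklyNull.
Variables (R : realType) (E : banachLatticeType R).
Implicit Types (x y u v z : E) (f g : dual E).

(** The part of [f] carried by the ideal that [I] describes: a supremum of [f] over [I] within
    [0, x], additive by Riesz decomposition. The conclusion states it through the two properties of
    a supremum. *)
Lemma band_functional (I : set E) f : 0 <=v f -> I 0 ->
  (forall y z, I y -> z <=v y -> I z) ->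
  (forall y z, I y -> I z -> I (y + z)) ->
  (forall a y, 0 <= a -> I y -> I (a *: y)) ->
  exists g, forall x, 0 <=v x ->
    (forall y, I y -> 0 <=v y -> y <=v x -> f y <= g x) /\
    (forall c, (forall y, I y -> 0 <=v y -> y <=v x -> f y <= c) -> g x <= c).
Proof.
move=> f0 I0 Is ID IZ; pose A x := [set f y | y in [set y | I y /\ 0 <=v y /\ y <=v x]].
have hs x : 0 <=v x -> has_sup (A x).
  move=> x0; split; first by exists (f 0), 0 => //; split=> //; split=> //; exact: vle_refl.
  by exists (f x) => _ [y [_ [y0 yx]] <-]; exact: dual_le.
have A_ge x y : 0 <=v x -> I y -> 0 <=v y -> y <=v x -> f y <= sup (A x).
  by move=> x0 Iy y0 yx; apply: (ub_le_sup (hs x x0).2); exists y.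
have A_le x c : 0 <=v x -> (forall y, I y -> 0 <=v y -> y <=v x -> f y <= c) -> sup (A x) <= c.
  by move=> x0 H; apply: (ge_sup (hs x x0).1) => _ [y [Iy [y0 yx]] <-]; exact: H.
have AZ a x : 0 < a -> 0 <=v x -> sup (A (a *: x)) <= a * sup (A x).
  move=> a0 x0; have ax0 := vle_scale_ge0 (ltW a0) x0.
  have ai : 0 <= a^-1 by rewrite invr_ge0 ltW.
  apply: (A_le) => // y Iy y0 yx; rewrite -ler_pdivrMl// -[_ * _]/(_ *: _) -linearZ.
  apply: A_ge => //; [exact: IZ|exact: vle_scale_ge0|].
  by rewrite -[x](@scalerK _ _ a) ?unitfE ?gt_eqF//; exact: vle_scale.
have [|||g gE] := @cone_extension R E (fun x => sup (A x)) `|f|.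
- move=> x y x0 y0; have xy0 := vaddr_ge0 x0 y0.
  apply/eqP; rewrite eq_le; apply/andP; split.
    apply: (A_le) => // z Iz z0 /(vriesz z0 y0 x0)[u [v [zE [u0 ux] [v0 vy]]]].
    rewrite zE linearD lerD// A_ge//; apply: (Is z) => //; rewrite zE.
      by rewrite -[X in X <=v _]addr0; exact: vle_add2l.
    by rewrite -[X in X <=v _]add0r; exact: vle_add2r.
  rewrite -lerBrDr; apply: (A_le) => // u Iu u0 ux; rewrite lerBrDl -lerBrDr.
  apply: (A_le) => // v Iv v0 vy; rewrite lerBrDl -linearD.
  apply: A_ge => //; [exact: ID|exact: vaddr_ge0|exact: vleD].
- move=> a x a0 x0; apply/eqP; rewrite eq_le AZ//=.
  rewrite mulrC -ler_pdivlMr// mulrC -[X in sup (A X) <= _](@scalerK _ _ a) ?unitfE ?gt_eqF//.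
  by apply: AZ; [rewrite invr_gt0|exact: vle_scale_ge0 (ltW a0) x0].
- move=> x x0; have h0 := vle_refl (0 : E).
  rewrite ger0_norm; last by rewrite -(linear0 f) A_ge.
  apply: (A_le) => // y _ y0 yx; rewrite (le_trans (ler_norm _))//.
  by rewrite (le_trans (dual_ler _ _))// ler_wpM2l// vle_norm0.
by exists g => x x0; rewrite gE//; split=> [y|c]; [exact: A_ge|exact: A_le].
Qed.

Lemma weakly_null_dominated (x w : nat -> E) : weakly_null x ->
  (forall n, 0 <=v w n) -> (forall n, w n <=v x n) -> weakly_null w.
Proof.
move=> wx w0 wn f.
have a0 : 0 <=v vabs f by exact: vabs_ge0.
apply/cvgr0Pnorm_le => e e0; have /cvgr0Pnorm_le/(_ e e0) := wx (vabs f).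
apply: filterS => n; apply: le_trans.
apply: le_trans (dual_abs_le f (w0 n)) _; apply: le_trans (dual_le a0 (wn n)) _.
exact: ler_norm.
Qed.

Lemma weakly_null_comp (x : nat -> E) (j : nat -> nat) :
  (forall i k, (i < k)%N -> (j i < j k)%N) -> weakly_null x -> weakly_null (x \o j).
Proof.
move=> ji wx f; apply/cvgrPdist_le => e e0.
have /cvgrPdist_le/(_ e e0)[N _ NP] := wx f.
exists N => // n /= Nn; apply: NP => /=.
exact: leq_trans Nn (strictly_increasing_ge ji n).
Qed.

(* The positive part of f carried by the band of the x_n^+ takes the value     *)
(* f (x_n^+) at x_n, because x_n^- is disjoint from that band.                  *)
Lemma disjoint_weakly_null_vpos (x : nat -> E) f : 0 <=v f ->
  disjoint_seq x -> weakly_null x -> f (vpos (x n)) @[n --> \oo] --> (0 : R).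
Proof.
move=> f0 dx wx; pose W k := \sum_(n < k) vpos (x n).
have W0 k : 0 <=v W k by apply: vsum_ge0 => i _; exact: vpos_ge0.
have WD k l : W k <=v W (k + l)%N.
  rewrite /W big_split_ord/= -[X in X <=v _]addr0; apply: vle_add2l.
  by apply: vsum_ge0 => i _; exact: vpos_ge0.
pose I y := exists (c : R) (k : nat), 0 <= c /\ y <=v c *: W k.
have [||||g gP] := @band_functional I f f0.
- by exists 0, 0%N; split=> //; rewrite scale0r; exact: vle_refl.
- by move=> y z [c [k [c0 yc]]] zy; exists c, k; split=> //; exact: vle_trans zy yc.
- move=> y z [c [k [c0 yc]]] [d [l [d0 zd]]]; exists (c + d), (k + l)%N.
  split; first exact: addr_ge0.
  rewrite scalerDl; apply: vleD.
    by apply: vle_trans yc _; apply: vle_scale => //; exact: WD.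
  by apply: vle_trans zd _; apply: vle_scale => //; rewrite addnC; exact: WD.
- move=> a y a0 [c [k [c0 yc]]]; exists (a * c), k; split; first exact: mulr_ge0.
  by rewrite -scalerA; exact: vle_scale.
have gp n : g (vpos (x n)) = f (vpos (x n)).
  have p0 := vpos_ge0 (x n); have [ge le_] := gP _ p0.
  apply/eqP; rewrite eq_le; apply/andP; split; last first.
    apply: (ge) => //; last exact: vle_refl.
    exists 1, n.+1; split=> //; rewrite scale1r /W big_ord_recr/=.
    rewrite -[X in X <=v _]add0r; apply: vle_add2r.
    by apply: vsum_ge0 => i _; exact: vpos_ge0.
  by apply: (le_) => y _ _ yx; exact: dual_le.
have gn n : g (vpos (- x n)) = 0.
  have p0 := vpos_ge0 (- x n); have [ge le_] := gP _ p0.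
  have z0 := vle_refl (0 : E).
  apply/eqP; rewrite eq_le; apply/andP; split; last first.
    rewrite -(linear0 f); apply: (ge) => //.
    by exists 0, 0%N; split=> //; rewrite scale0r.
  apply: (le_) => y [c [k [c0 yc]]] y0 yx; rewrite -(linear0 f); apply: dual_le => //.
  suff <- : vinf (vpos (- x n)) (c *: W k) = 0 by apply: vle_inf.
  apply: vinf_disjZ => //; elim: k {yc} => [|k IH].
    by rewrite /W big_ord0; apply: vle_anti; [exact: vle_infr|exact: vinf_ge0].
  have -> : W k.+1 = W k + vpos (x k) by rewrite /W big_ord_recr.
  apply: vinf_disjD => //; first exact: vpos_ge0.
  have [->|nk] := eqVneq n k; first by rewrite vinfC vinf_pos_neg.
  apply: vinf_disj_le (dx n k nk); try exact: vpos_ge0.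
    by apply: vle_sup; [exact: vle_absN|exact: vabs_ge0].
  by apply: vle_sup; [exact: vle_abs|exact: vabs_ge0].
have -> : (fun n => f (vpos (x n))) = (fun n => g (x n)).
  apply/funext => n; rewrite -gp -[RHS]addr0 -(gn n).
  rewrite -[RHS]/(g (x n) + g (vpos (- x n))).
  have -> : vpos (x n) = x n + vpos (- x n) by rewrite vposN addrC subrK.
  exact: linearD.
exact: wx.
Qed.

Lemma disjoint_weakly_null_vabs (x : nat -> E) :
  disjoint_seq x -> weakly_null x -> weakly_null (fun n => vabs (x n)).
Proof.
move=> dx wx.
have pos f : 0 <=v f -> f (vabs (x n)) @[n --> \oo] --> (0 : R).
  move=> f0; have dN : disjoint_seq (fun n => - x n).
    by move=> n k nk; rewrite !vabsN; exact: dx.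
  have wN : weakly_null (fun n => - x n).
    move=> h; have -> : (fun n => h (- x n)) = (fun n => - h (x n)).
      by apply/funext => n; exact: linearN.
    by rewrite -oppr0; apply: cvgN; exact: wx.
  have -> : (fun n => f (vabs (x n))) = (fun n => f (vpos (x n)) + f (vpos (- x n))).
    by apply/funext => n; rewrite vabsE; exact: linearD.
  by rewrite -[X in _ --> X](addr0 0); apply: cvgD; exact: disjoint_weakly_null_vpos.
move=> f; apply/cvgr0Pnorm_le => e e0.
have /cvgr0Pnorm_le/(_ e e0) := pos _ (vabs_ge0 f).
apply: filterS => n; apply: le_trans.
by rewrite (le_trans (dual_abs_le _ (vabs_ge0 _)))// ler_norm.
Qed.

(** Links the property, stated for positive sequences, with the disjoint sequences that test almost
    Dunford-Pettis operators: moduli of disjoint weakly null sequences are again weakly null. *)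
Lemma positive_Schur_disjoint (x : nat -> E) : positive_Schur E ->
  disjoint_seq x -> weakly_null x -> x n @[n --> \oo] --> (0 : E).
Proof.
move=> sE dx wx; have := sE _ (fun n => vabs_ge0 (x n)) (disjoint_weakly_null_vabs dx wx).
move=> /cvgr0Pnorm_le H; apply/cvgr0Pnorm_le => e e0.
by apply: filterS (H e e0) => n; rewrite norm_vabs.
Qed.

End WeaklyNull.

(** * Disjoint witnesses against the positive Schur property of a dual *)

Section WeaklyNullDual.
Variables (R : realType) (X : banachLatticeType R).
Implicit Types (x : nat -> dual X).

Lemma dual_eval_subproof (v : X) : (fun f : dual X => f v) \in @dual_pred R (dual X).
Proof.
apply: (dual_pred_bounded (M := `|v|)) => [a f g|f] //.
by rewrite mulrC; exact: dual_ler.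
Qed.

Definition dual_eval v : dual (dual X) := Dual (dual_eval_subproof v).

(** Uniform boundedness on [X]; only the evaluation functionals on the dual are tested. *)
Lemma weakly_null_bounded x : weakly_null x -> exists M, forall n, `|x n| <= M.
Proof.
move=> wx; pose A := [set (x n : X -> R^o) | n in setT].
have [||M MP] := @Banach_Steinhauss R X R^o A _ _ 1.
- move=> _ [n _ <-]; split; last by have [] := dualP (x n).
  move=> r; exists (`|x n| * r) => v vr; apply: le_trans (dual_ler _ _) _.
  exact: ler_wpM2l.
- move=> v; have /cvgP/cvg_seq_bounded[M [_ MP]] := wx (dual_eval v).
  exists (M + 1) => _ [n _ <-].
  by apply: (MP (M + 1)) => //; rewrite ltrDl ltr01.
exists M => n; have M0 : 0 <= M.
  have /(_ 0) := MP (x n) (imageP _ I); rewrite normr0 => /(_ ler01).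
  exact: le_trans.
apply: dual_norm_ub => // v; have [->|v0] := eqVneq v 0.
  by rewrite linear0 !normr0 mulr0.
have nv : 0 < `|v| by rewrite normr_gt0.
have /(_ (`|v|^-1 *: v)) := MP (x n) (imageP _ I).
rewrite normrZ normfV normr_id mulVf ?gt_eqF// => /(_ (lexx _)).
rewrite linearZ/= normrZ normfV normr_id mulrC ler_pdivrMr//.
Qed.

Lemma dual_norm_attained (z : dual X) e : 0 <=v z -> e < `|z| ->
  exists v, [/\ 0 <=v v, `|v| <= 1 & e <= z v].
Proof.
move=> z0 ez; apply: contrapT => /forallNP H; move: ez; apply/negP; rewrite -leNgt.
apply: ge_sup; first exact: (dual_has_sup z).1.
move=> _ [v /= v1 <-]; rewrite leNgt; apply/negP => ev; apply: (H (vabs v)).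
split; [exact: vabs_ge0|by rewrite norm_vabs|].
apply: le_trans (ltW ev) _; rewrite ler_norml.
rewrite (dual_le z0 (vle_abs v)) andbT lerNl -linearN.
by apply: dual_le => //; exact: vle_absN.
Qed.

(** The pointwise limit. Its last property, a lower bound at each single vector, is what keeps the
    infimum large at the norming vectors. *)
Lemma decreasing_dual_inf (g : nat -> dual X) : (forall n, 0 <=v g n) ->
  (forall n, g n.+1 <=v g n) ->
  exists h : dual X, [/\ 0 <=v h, forall n, h <=v g n &
    forall v c, (forall n, c <= g n v) -> c <= h v].
Proof.
move=> g0 gd; have gm i k : (i <= k)%N -> g k <=v g i.
  move=> /subnK <-; elim: (k - i)%N => [|n IH]; first exact: vle_refl.
  by rewrite addSn; exact: vle_trans (gd _) IH.
have cpos v : 0 <=v v -> cvgn (fun n => g n v).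
  move=> v0; apply: nonincreasing_is_cvgn; first by move=> i k ik; exact: gm.
  by exists 0 => _ [n _ <-]; exact: dual_ge0.
have cv v : cvgn (fun n => g n v).
  have -> : (fun n => g n v) = (fun n => g n (vpos v) - g n (vpos (- v))).
    by apply/funext => n; rewrite -linearB vposN subKr.
  by apply: is_cvgB; apply: cpos; exact: vpos_ge0.
pose h v := limn (fun n => g n v).
have hl : linear h.
  move=> a u v; apply: (cvg_lim (@Rhausdorff R)).
  have -> : (fun n => g n (a *: u + v)) = (fun n => a * g n u + g n v).
    by apply/funext => n; rewrite linearP.
  by apply: cvgD; [apply: cvgM; [exact: cvg_cst|exact: cv]|exact: cv].
have hM v : `|h v| <= `|g 0| * `|v|.
  apply: (cvgr_to_le (cvg_norm (cv v))); near=> n.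
  rewrite (le_trans (dual_ler _ _))// ler_wpM2r//; apply: vle_norm0 => //.
  exact: gm.
exists (Dual (dual_pred_bounded hl hM)); split.
- move=> v v0; apply: (cvgr_to_ge (cv v)); near=> n; exact: dual_ge0.
- move=> n v v0; apply: (cvgr_to_le (cv v)); near=> k.
  by apply: gm => //; near: k; exact: nbhs_infty_ge.
- by move=> v c cg; apply: (cvgr_to_ge (cv v)); near=> n; exact: cg.
Unshelve. all: by end_near. Qed.

(* Along a subsequence y_n of the given sequence, with v_n in the positive ball *)
(* almost norming y_n, put                                                      *)
(*   z_n = inf_N (y_n - sum_(n < k < N) c_k y_k)^+,                             *)
(*   w_n = (z_n - c_n^-1 sum_(k < n) y_k)^+,                                    *)
(* where c_k depends on y_0, ..., y_(k-1) only and y_k is chosen afterwards so  *)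
(* that c_k y_k (v_n) is small for n < k. The infimum exists, and is controlled *)
(* at v_n, because it is a pointwise infimum of functionals.                    *)
Lemma not_positive_Schur_dual : ~ positive_Schur (dual X) ->
  exists (w : nat -> dual X) (v : nat -> X) (e : R),
    [/\ 0 < e, forall n, 0 <=v w n, disjoint_seq w, weakly_null w &
     forall n, [/\ 0 <=v v n, `|v n| <= 1 & e <= w n (v n)]].
Proof.
move=> /existsNP[x /not_implyP[x0 /not_implyP[wx nx]]].
have [e e0 ex] : exists2 e : R, 0 < e & forall N, exists2 n, (N <= n)%N & e < `|x n|.
  apply: contrapT => H; apply: nx; apply/cvgr0Pnorm_le => e e0.
  apply: contrapT => ne; apply: H; exists e => // N; apply: contrapT => Nn.
  apply: ne; exists N => // n /= Nn'; rewrite leNgt; apply/negP => ?.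
  by apply: Nn; exists n.
(* The default 0 never occurs along the subsequence chosen below, which keeps only [n] with
   [e < |x n|]. *)
pose xi n : X := if pselect (e < `|x n|) is left en
  then projT1 (cid (dual_norm_attained (x0 n) en)) else 0.
have xiP n : e < `|x n| -> [/\ 0 <=v xi n, `|xi n| <= 1 & e <= x n (xi n)].
  move=> en; rewrite /xi; case: pselect => // en'.
  exact: projT2 (cid (dual_norm_attained (x0 n) en')).
have ev v d : 0 < d -> exists N, forall n, (N <= n)%N -> x n v <= d.
  move=> d0; have /cvgr0Pnorm_le/(_ d d0)[N _ NP] := wx (dual_eval v).
  by exists N => n /NP/=; apply: le_trans; exact: ler_norm.
(* Chosen so that the sum of the earlier norms divided by [cof s] is at most [e / 4], the loss
   allowed in passing from z_n to w_n. *)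
pose cof s := 1 + 4 / e * \sum_(k <- s) `|x k|.
have cof1 s : 1 <= cof s by rewrite lerDl mulr_ge0// ?sumr_ge0// divr_ge0// ltW.
(* The geometric weights make the later terms cost at most [e / 2] in total at each v_n, so z_n
   keeps at least [e / 2] there. *)
have [s|j [ji jP]] := @dependent_subsequence (fun s n => e < `|x n| /\
    cof s * x n (\sum_(k <- s) xi k) <= e / 4 * 2^-1 ^+ size s).
  have c0 : 0 < cof s := lt_le_trans ltr01 (cof1 s).
  have d0 : 0 < e / 4 * 2^-1 ^+ size s / cof s.
    by rewrite divr_gt0// mulr_gt0 ?divr_gt0// exprn_gt0// invr_gt0.
  have [N NP] := ev (\sum_(k <- s) xi k) _ d0.
  have [n Nn en] := ex (maxn N (\max_(i <- s) i).+1).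
  exists n; split=> [i is_|]; last first.
    split=> //; rewrite mulrC -ler_pdivlMr//; apply: NP.
    by apply: leq_trans Nn; exact: leq_maxl.
  by apply: leq_trans Nn; rewrite leq_max ltnS (leq_bigmax_seq (F := id))// orbT.
pose y n := x (j n); pose v n := xi (j n); pose c n := cof [seq j k | k <- iota 0 n].
have y0 n : 0 <=v y n by exact: x0.
have vP n : [/\ 0 <=v v n, `|v n| <= 1 & e <= y n (v n)] by apply: xiP; have [] := jP n.
have v0 n : 0 <=v v n by have [] := vP n.
have c1 n : 1 <= c n by exact: cof1.
have cp n : 0 < c n := lt_le_trans ltr01 (c1 n).
have cp' n : 0 <= c n := ltW (cp n).
have iotaE n : iota 0 n = index_iota 0 n by rewrite /index_iota subn0.
have cE n : c n = 1 + 4 / e * \sum_(k < n) `|y k|.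
  by rewrite /c /cof big_map iotaE big_mkord.
have cv n k : (n < k)%N -> c k * y k (v n) <= e / 4 * 2^-1 ^+ k.
  move=> nk; have [_] := jP k; rewrite -/(c k) size_map size_iota; apply: le_trans.
  rewrite ler_wpM2l// dual_le// big_map iotaE big_mkord (bigD1 (Ordinal nk))//=.
  rewrite -[X in X <=v _]addr0; apply: vle_add2l.
  by apply: vsum_ge0 => i _; exact: v0.
have geo n N : \sum_(n <= k < N) (2^-1 : R) ^+ k <= 2.
  have [Nn|/ltnW nN] := leqP N n; first by rewrite big_geq.
  suff : \sum_(n <= k < N) (2^-1 : R) ^+ k = 2 * (2^-1 ^+ n - 2^-1 ^+ N).
    have i0 : 0 <= 2^-1 :> R by rewrite invr_ge0.
    have i1 : 2^-1 <= 1 :> R by rewrite invf_le1// ler1n.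
    by have := exprn_ge0 N i0; have := exprn_ile1 n i0 i1 => h1 h2 ->; lra.
  elim: N nN => [|N IH].
    by rewrite leqn0 => /eqP ->; rewrite big_geq// subrr mulr0.
  rewrite leq_eqVlt => /predU1P[<-|]; first by rewrite big_geq// subrr mulr0.
  by rewrite ltnS => nN; rewrite big_nat_recr//= IH// exprS; field.
pose G n N := vpos (y n - \sum_(n.+1 <= k < N) c k *: y k).
have tail0 n N : 0 <=v \sum_(n.+1 <= k < N) c k *: y k.
  by apply: vsum_ge0 => k _; exact: vle_scale_ge0.
have G0 n N : 0 <=v G n N by exact: vpos_ge0.
have Gd n N : G n N.+1 <=v G n N.
  apply: vpos_le; apply: vle_add2l; apply: vleN.
  have [nN|Nn] := leqP n.+1 N; last by rewrite big_geq ?(ltnW Nn)// big_geq//; exact: vle_refl.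
  rewrite big_nat_recr//= -[X in X <=v _]addr0; apply: vle_add2l.
  exact: vle_scale_ge0.
have Ge n N : e / 2 <= G n N (v n).
  have /(_ _ (v0 n)) := vle_pos (y n - \sum_(n.+1 <= k < N) c k *: y k).
  rewrite -/(G n N); apply: le_trans; rewrite dualDE dualNE dual_sumE.
  have [_ _ eyn] := vP n.
  have : \sum_(n.+1 <= k < N) (c k *: y k) (v n) <= e / 4 * \sum_(n.+1 <= k < N) 2^-1 ^+ k.
    rewrite mulr_sumr; apply: ler_sum_nat => k /andP[nk _]; exact: cv.
  have : e / 4 * \sum_(n.+1 <= k < N) 2^-1 ^+ k <= e / 4 * 2.
    by rewrite ler_wpM2l// divr_ge0// ltW.
  lra.
pose z n := projT1 (cid (decreasing_dual_inf (G0 n) (Gd n))).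
have zP n : [/\ 0 <=v z n, forall N, z n <=v G n N &
    forall v c, (forall N, c <= G n N v) -> c <= z n v].
  exact: projT2 (cid (decreasing_dual_inf (G0 n) (Gd n))).
have z0 n : 0 <=v z n by have [] := zP n.
have zG n N : z n <=v G n N by have [] := zP n.
have zv n : e / 2 <= z n (v n) by have [_ _] := zP n; apply => N; exact: Ge.
have zy n : z n <=v y n by have := zG n 0; rewrite /G big_geq// subr0 vpos_id.
pose w n := vpos (z n - (c n)^-1 *: \sum_(k < n) y k).
have w0 n : 0 <=v w n by exact: vpos_ge0.
have ci n : 0 <= (c n)^-1 by rewrite invr_ge0.
have head0 n : 0 <=v (c n)^-1 *: \sum_(k < n) y k.
  by apply: vle_scale_ge0 => //; apply: vsum_ge0.
have wz n : w n <=v z n.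
  apply: vle_sup => //; apply/vlerBl; rewrite -[X in X <=v _]addr0.
  exact: vle_add2l.
exists w, v, (e / 4); split=> //; first by rewrite divr_gt0.
(* For n < k, w_n is below the positive part of y_n - c_k y_k, and w_k is below 1 / c_k times its
   negative part. *)
- have dis n k : (n < k)%N -> vinf (w n) (w k) = 0.
    move=> nk.
    apply: (vinf_disj_le (u := vpos (y n - c k *: y k))
      (v := (c k)^-1 *: vpos (- (y n - c k *: y k)))) => //.
    + apply: vle_trans (wz n) _; apply: vle_trans (zG n k.+1) _; apply: vpos_le.
      apply: vle_add2l; apply: vleN; rewrite big_nat_recr//= -[X in X <=v _]add0r.
      exact: vle_add2r.
    + rewrite -vposZ//; apply: vpos_le; rewrite opprB scalerBr scalerA mulVf ?gt_eqF//.
      rewrite scale1r; apply: vleD => //; apply: vleN; apply: vle_scale => //.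
      rewrite (bigD1 (Ordinal nk))//= -[X in X <=v _]addr0; apply: vle_add2l.
      by apply: vsum_ge0.
    + by apply: vinf_disjZ => //; [exact: vpos_ge0|exact: vpos_ge0|exact: vinf_pos_neg].
  move=> n k nk; rewrite !vabs_pos//; have [/dis//|/dis|/eqP] := ltngtP n k.
    by rewrite vinfC.
  by rewrite (negbTE nk).
- apply: (weakly_null_dominated (weakly_null_comp ji wx)) => // n.
  exact: vle_trans (wz n) (zy n).
- move=> n; have [vn vn1 _] := vP n; split=> //.
  have /(_ _ vn) := vle_pos (z n - (c n)^-1 *: \sum_(k < n) y k).
  rewrite -/(w n); apply: le_trans; rewrite dualDE dualNE dualZE dual_sumE.
  have : (c n)^-1 * \sum_(k < n) y k (v n) <= e / 4.
    have cEe : c n * (e / 4) = e / 4 + \sum_(k < n) `|y k|.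
      by rewrite cE; field; rewrite gt_eqF.
    rewrite ler_pdivrMl// cEe; apply: le_trans (_ : _ <= \sum_(k < n) `|y k|) _.
      apply: ler_sum => k _; rewrite (le_trans (ler_norm _))//.
      by rewrite (le_trans (dual_ler _ _))// ler_piMr.
    by rewrite lerDr divr_ge0// ltW.
  by have := zv n; lra.
Qed.

End WeaklyNullDual.

(** * Order sums *)

Section OrderSum.
Variables (R : realType) (F : banachLatticeType R).
Variables (y : nat -> F) (b : F).
Hypotheses (sF : sigma_Dedekind_complete F) (y0 : forall n, 0 <=v y n)
  (yb : forall n, \sum_(k < n) y k <=v b).
Implicit Types (a : linf R) (s t u : F).

Let P n (a : linf R) : F := \sum_(k < n) a k *: y k.
Let Y n : F := \sum_(k < n) y k.

Lemma sigma_sup (x : nat -> F) c : (forall n, x n <=v c) ->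
  exists s, (forall n, x n <=v s) /\ forall d, (forall n, x n <=v d) -> s <=v d.
Proof.
move=> xc; have [|||s [s1 s2]] := @sF (range x).
- exact: (sub_countable (card_image_le x _)) (countableP _).
- by exists (x 0), 0%N.
- by exists c => _ [n _ <-].
exists s; split=> [n|d xd]; first by apply: s1; exists n.
by apply: s2 => _ [n _ <-].
Qed.

(* S a is the order limit of the partial sums P n a, characterised by           *)
(* |S a - P n a| <= c (z - Y n) for some c, where z = sup Y; this form of       *)
(* convergence makes linearity immediate.                                       *)
Lemma order_sum_exists : exists S : linf R -> F, linear S /\
  forall a, (forall n, 0 <= a n) -> forall n, a n *: y n <=v S a.
Proof.
have [z [Yz zP]] := sigma_sup yb; rewrite -/(Y _) in Yz zP.
pose D n := z - Y n.
have D0 n : 0 <=v D n by apply/vsubr_ge0; exact: Yz.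
have YD n k : Y n <=v Y (n + k)%N.
  rewrite /Y big_split_ord/= -[X in X <=v _]addr0; apply: vle_add2l.
  by apply: vsum_ge0 => i _.
have DD n k : D (n + k)%N <=v D n by apply: vle_add2l; apply: vleN; exact: YD.
(* Otherwise z - u / (c + 1) would contradict the leastness of z; [c + 1] avoids dividing by 0. *)
have D_inf u c : 0 <= c -> (forall n, u <=v c *: D n) -> u <=v 0.
  move=> c0 uc; have c1 : 0 < c + 1 by rewrite ltr_wpDl.
  have uD n : (c + 1)^-1 *: u <=v D n.
    rewrite -[D n](@scalerK _ _ (c + 1)) ?unitfE ?gt_eqF//.
    apply: vle_scale; first by rewrite invr_ge0 ltW.
    apply: vle_trans (uc n) _; apply: vle_scalel => //; lra.
  have /vsubr_ge0 : z <=v z - (c + 1)^-1 *: u.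
    apply: zP => n; apply/vsubr_ge0; rewrite addrAC; apply/vsubr_ge0; exact: uD.
  rewrite addrAC subrr add0r => /voppr_le0; rewrite opprK.
  move=> /(vle_scale (ltW c1)); rewrite scalerA mulfV ?gt_eqF// scale1r.
  by rewrite scaler0.
pose rel a s := exists2 c : R, 0 <= c & forall n, vabs (s - P n a) <=v c *: D n.
have relP k a a' s s' : rel a s -> rel a' s' -> rel (k *: a + a') (k *: s + s').
  move=> [c c0 ac] [c' c0' ac']; exists (`|k| * c + c'); first by rewrite addr_ge0// mulr_ge0.
  move=> n; have -> : k *: s + s' - P n (k *: a + a') = k *: (s - P n a) + (s' - P n a').
    rewrite scalerBr addrACA -opprD; congr (_ - _).
    rewrite /P scaler_sumr -big_split/=; apply: eq_bigr => i _.
    by rewrite scalerA -scalerDl.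
  apply: vle_trans (vabsD _ _) _; rewrite scalerDl; apply: vleD => //.
  by rewrite vabsZ -scalerA; apply: vle_scale.
have rel_uniq a s s' : rel a s -> rel a s' -> s = s'.
  have H t t' : rel a t -> rel a t' -> t <=v t'.
    move=> [c c0 ac] [c' c0' ac']; apply/vsubr_ge0; rewrite -opprB.
    rewrite -oppr0; apply: vleN; apply: (D_inf _ (c + c')); first exact: addr_ge0.
    move=> n; rewrite scalerDl; apply: vle_trans (vleD (ac n) (ac' n)).
    have -> : t - t' = (t - P n a) + (P n a - t') by rewrite addrA subrK.
    apply: vleD; first exact: vle_abs.
    by rewrite -opprB; exact: vle_absN.
  by move=> h1 h2; apply: vle_anti; exact: H.
have rel_pos a : (forall n, 0 <= a n) -> exists s, rel a s.
  move=> a0; have aM n : a n <= `|a| by rewrite (le_trans (ler_norm _))// linf_norm_ge.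
  have PM n k : P (n + k)%N a <=v P n a + `|a| *: (Y (n + k)%N - Y n).
    elim: k => [|k IH]; first by rewrite addn0 subrr scaler0 addr0; exact: vle_refl.
    rewrite addnS {1}/P big_ord_recr/= -/(P _ a) {1}/Y big_ord_recr/= -/(Y _).
    rewrite addrAC scalerDr addrA; apply: vleD => //; exact: vle_scalel.
  have PD n k : P n a <=v P (n + k)%N a.
    rewrite /P big_split_ord/= -[X in X <=v _]addr0; apply: vle_add2l.
    by apply: vsum_ge0 => i _; apply: vle_scale_ge0; [exact: a0|exact: y0].
  have Pb n k : P k a <=v P n a + `|a| *: D n.
    apply: vle_trans (PD k n) _; rewrite addnC; apply: vle_trans (PM n k) _.
    by apply: vle_add2l; apply: vle_scale => //; apply: vle_add2r; exact: Yz.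
  have [s [Ps sP]] := sigma_sup (Pb 0%N).
  exists s; exists `|a| => // n; rewrite vabs_pos; last exact/vsubr_ge0.
  by apply/vlerBl; rewrite addrC; apply: sP => k; exact: Pb.
(* Write [a] as a nonnegative sequence minus the constant sequence [|a|]. *)
have rel_ex a : exists s, rel a s.
  pose one : linf R := `|a| *: linf_ind R [set: nat].
  have oneE n : one n = `|a|.
    by rewrite -[LHS]/(`|a| * linf_ind R setT n) linf_indE asboolT// mulr1.
  have one0 n : 0 <= one n by rewrite oneE.
  have a10 n : 0 <= (a + one) n.
    rewrite linfDE oneE -lerBlDr sub0r lerNl (le_trans (ler_norm _))// normrN.
    exact: linf_norm_ge.
  have [s rs] := rel_pos _ one0; have [s' rs'] := rel_pos _ a10.
  exists ((-1) *: s + s'); have -> : a = (-1) *: one + (a + one).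
    by rewrite scaleN1r addrC addrK.
  exact: relP.
pose S a := projT1 (cid (rel_ex a)).
have SP a : rel a (S a) := projT2 (cid (rel_ex a)).
exists S; split=> [k a a'|a a0 n]; first by apply: rel_uniq (SP _) _; exact: relP.
apply/vsubr_ge0; rewrite -opprB -oppr0; apply: vleN.
have [c c0 ac] := SP a; apply: (D_inf _ c) => // k.
(* The partial sum of length [k + n.+1] contains the n-th term; the error bound at that index is
   relaxed to [c *: D k]. *)
apply: vle_trans (vle_scale c0 (DD k n.+1)); apply: vle_trans (ac (k + n.+1)%N).
apply: vle_trans (vle_absN _); rewrite opprB; apply: vle_add2r.
rewrite addnC /P big_split_ord/= big_ord_recr/= -addrA addrCA.
rewrite -[X in X <=v _]addr0; apply: vle_add2l; apply: vaddr_ge0;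
  by apply: vsum_ge0 => i _; apply: vle_scale_ge0; [exact: a0|exact: y0].
Qed.

End OrderSum.

(** * Bounds for multilinear operators *)

Section MultilinearBounds.
Variables (R : realType) (m : nat).

Section Slices.
Variables (E : 'I_m -> lmodType R) (F : lmodType R) (A : (forall i, E i) -> F).
Hypothesis lA : multilinear A.

Lemma dfwith_id (x : forall i, E i) k : dfwith x (x k) = x.
Proof.
apply: functional_extensionality_dep => i.
by have [<-|ki] := eqVneq k i; [rewrite dfwith_in|rewrite dfwith_out].
Qed.

Lemma multilinearD k x (s t : E k) :
  A (dfwith x (s + t)) = A (dfwith x s) + A (dfwith x t).
Proof. by have := lA x 1 s t; rewrite !scale1r. Qed.

Lemma multilinearB k x (s t : E k) :
  A (dfwith x (s - t)) = A (dfwith x s) - A (dfwith x t).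
Proof.
by rewrite addrC -scaleN1r (lA x) scaleN1r addrC.
Qed.

End Slices.

Section Lattices.
Variables (E : 'I_m -> banachLatticeType R) (F : banachLatticeType R).
Implicit Types (A : (forall i, E i) -> F) (x u v : forall i, E i).

Lemma dfwith_map (G H : 'I_m -> Type) (f : forall i, G i -> H i) (x : forall i, G i)
    k (t : G k) : (fun i => f i (dfwith x t i)) = dfwith (fun i => f i (x i)) (f k t).
Proof.
apply: functional_extensionality_dep => i.
have [<-|ki] := eqVneq k i; first by rewrite !dfwith_in.
by rewrite !dfwith_out.
Qed.

Lemma dfwith_ge0 x k (t : E k) :
  (forall i, 0 <=v x i) -> 0 <=v t -> forall i, 0 <=v dfwith x t i.
Proof.
move=> x0 t0 i; have [<-|ki] := eqVneq k i; first by rewrite dfwith_in.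
by rewrite dfwith_out.
Qed.

(** Split one coordinate at a time into positive and negative parts; the two values are subtracted
    on the left and added on the right. *)
Lemma positive_multilinear_vabs A x : positive_multilinear A ->
  vabs (A x) <=v A (fun i => vabs (x i)).
Proof.
move=> [lA A0]; pose av (z : forall i, E i) i := vabs (z i).
suff H (s : seq 'I_m) z : (forall i, i \notin s -> 0 <=v z i) ->
    vabs (A z) <=v A (av z).
  by apply: (H (enum 'I_m)) => i; rewrite mem_enum.
elim: s z => [|k s IH] z z0.
  have -> : av z = z by apply: functional_extensionality_dep => i; apply: vabs_pos; exact: z0.
  rewrite vabs_pos; first exact: vle_refl.
  by apply: A0 => i; exact: z0.
have dz0 (t : E k) : 0 <=v t -> forall i, i \notin s -> 0 <=v dfwith z t i.
  move=> t0 i is_; have [<-|ki] := eqVneq k i; first by rewrite dfwith_in.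
  by rewrite dfwith_out//; apply: z0; rewrite inE negb_or eq_sym ki.
have avd (t : E k) : 0 <=v t -> av (dfwith z t) = dfwith (av z) t.
  by move=> t0; rewrite /av (dfwith_map (fun i => @vabs R (E i))) vabs_pos.
have p0 := vpos_ge0 (z k); have n0 := vpos_ge0 (- z k).
have -> : A z = A (dfwith z (vpos (z k))) - A (dfwith z (vpos (- z k))).
  by rewrite -multilinearB// vposN subKr dfwith_id.
have -> : A (av z) = A (dfwith (av z) (vpos (z k))) + A (dfwith (av z) (vpos (- z k))).
  by rewrite -multilinearD// -vabsE -[vabs _]/(av z k) dfwith_id.
rewrite -!avd//; apply: vle_trans (vabsD _ _) _; rewrite vabsN.
by apply: vleD; apply: IH; exact: dz0.
Qed.

Lemma positive_multilinear_le A u v : positive_multilinear A ->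
  (forall i, 0 <=v u i) -> (forall i, u i <=v v i) -> A u <=v A v.
Proof.
move=> [lA A0] u0 uv; pose mix (s : seq 'I_m) i := if i \in s then v i else u i.
suff H (s : seq 'I_m) : A u <=v A (mix s).
  have -> : v = mix (enum 'I_m); last exact: H.
  by apply: functional_extensionality_dep => i; rewrite /mix mem_enum.
elim: s => [|k s IH].
  have -> : mix [::] = u by apply: functional_extensionality_dep => i.
  exact: vle_refl.
apply: vle_trans IH _; have [ks|ks] := boolP (k \in s).
  suff -> : mix (k :: s) = mix s by exact: vle_refl.
  apply: functional_extensionality_dep => i; rewrite /mix inE.
  by have [->|//] := eqVneq i k; rewrite ks.
have -> : mix (k :: s) = dfwith (mix s) (v k).
  apply: functional_extensionality_dep => i; rewrite /mix inE.
  have [->|ik] := eqVneq i k; first by rewrite dfwith_in.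
  by rewrite dfwith_out// eq_sym.
have uk : u k = mix s k by rewrite /mix (negbTE ks).
rewrite -[in X in X <=v _](dfwith_id (mix s) k) -uk.
apply/vsubr_ge0; rewrite -multilinearB//; apply: A0.
apply: dfwith_ge0; last exact/vsubr_ge0.
move=> i; rewrite /mix; case: ifP => _ //; exact: vle_trans (u0 i) (uv i).
Qed.

(** If unbounded, pick x_n with [|A x_n|] beyond n (2^n)^m and sum 2^-n x_n in each coordinate. The
    limit dominates every 2^-n x_n, so by monotonicity its image has norm above every n. *)
Lemma positive_multilinear_bounded_ball A : positive_multilinear A ->
  exists M, forall x, (forall i, 0 <=v x i) -> (forall i, `|x i| <= 1) -> `|A x| <= M.
Proof.
move=> pA; have [lA A0] := pA; apply: contrapT => /forallNP H.
pose M n : R := n%:R * (2 ^+ n) ^+ m.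
have {}H n : exists x, [/\ forall i, 0 <=v x i, forall i, `|x i| <= 1 & M n < `|A x|].
  have /existsNP[x /not_implyP[x0 /not_implyP[x1 /negP]]] := H (M n).
  by rewrite -ltNge => ?; exists x.
pose x n := projT1 (cid (H n)).
have xP n : [/\ forall i, 0 <=v x n i, forall i, `|x n i| <= 1 & M n < `|A (x n)|].
  exact: projT2 (cid (H n)).
have x0 n i : 0 <=v x n i by have [] := xP n.
have h0 n : 0 <= (2^-1 : R) ^+ n by rewrite exprn_ge0// invr_ge0.
pose z i n := (2^-1 : R) ^+ n *: x n i.
have z0 i n : 0 <=v z i n by exact: vle_scale_ge0.
have cz i : cvgn (series (z i)).
  apply: normed_cvg; apply: (@series_le_cvg _ _ (geometric 1 2^-1)).
  - by move=> n /=; exact: normr_ge0.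
  - by move=> n; rewrite /geometric/= mul1r.
  - move=> n; rewrite /geometric/= mul1r normrZ ger0_norm// ler_piMr//.
    by have [_ x1 _] := xP n; exact: x1.
  - by apply: is_cvg_geometric_series; rewrite ger0_norm ?invr_ge0// invf_lt1// ltr1n.
pose y i := limn (series (z i)).
have zy i n : z i n <=v y i.
  have sn : series (z i) (n.+1 + k)%N @[k --> \oo] --> y i.
    rewrite (_ : (fun k => _) = fun k => series (z i) (k + n.+1)%N); last first.
      by apply/funext => k; rewrite addnC.
    by rewrite (cvg_shiftn n.+1 (series (z i))); exact: cz.
  apply: (vle_cvg _ (cvg_cst (z i n)) sn) => k.
  rewrite seriesEord/= big_split_ord/= big_ord_recr/=.
  rewrite addrAC -[X in X <=v _]add0r; apply: vle_add2r.
  by apply: vaddr_ge0; apply: vsum_ge0 => j _.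
have Ay n : n%:R < `|A y|.
  have [_ _ An] := xP n.
  have : `|A (fun i => z i n)| <= `|A y|.
    apply: vle_norm0; first exact: A0.
    exact: positive_multilinear_le.
  apply: lt_le_trans; rewrite /z (multilinear_scale (fun=> 2^-1 ^+ n))//.
  rewrite prodr_const card_ord normrZ ger0_norm ?exprn_ge0 ?invr_ge0//.
  by rewrite !exprVn mulrC ltr_pdivlMr ?exprn_gt0.
have := Ay (Num.truncn `|A y|).+1; apply/negP; rewrite -leNgt ltW//.
exact: truncnS_gt.
Qed.

Lemma positive_multilinear_bounded A : positive_multilinear A ->
  exists2 M, 0 <= M & forall x, `|A x| <= M * \prod_i `|x i|.
Proof.
move=> pA; have [lA A0] := pA; have [M MP] := positive_multilinear_bounded_ball pA.
exists `|M| => // x; pose u i := `|x i|^-1 *: x i.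
have xu : x = (fun i => `|x i| *: u i).
  apply: functional_extensionality_dep => i; rewrite /u scalerA.
  have [->|xi] := eqVneq (x i) 0; first by rewrite scaler0.
  by rewrite mulfV ?scale1r// normr_eq0.
rewrite [in A x]xu (multilinear_scale (fun i => `|x i|))// normrZ ger0_norm ?prodr_ge0//.
rewrite mulrC ler_wpM2r ?prodr_ge0//.
have : `|A u| <= `|A (fun i => vabs (u i))|.
  by apply: vle_norm_pos; exact: positive_multilinear_vabs.
move/le_trans; apply; apply: le_trans (ler_norm M); apply: MP => i.
  exact: vabs_ge0.
rewrite norm_vabs normrZ normfV normr_id.
have [->|xi] := eqVneq (x i) 0; first by rewrite normr0 mulr0.
by rewrite mulVf// normr_eq0.
Qed.

End Lattices.

(** Pass from [x] to [y] one coordinate at a time: each change is a value of [A] with [y k - x k] in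
    coordinate [k], while the other coordinates stay bounded near [x]. *)
Lemma bounded_multilinear_continuous (E : 'I_m -> normedModType R)
    (F : normedModType R) (A : (forall i, E i) -> F) M :
  multilinear A -> (forall x, `|A x| <= M * \prod_i `|x i|) -> cts_multilinear A.
Proof.
move=> lA AM; split=> // x.
pose mix (s : seq 'I_m) (y : prod_topology E) : prod_topology E :=
  fun i => if i \in s then y i else x i.
suff H (s : seq 'I_m) : A (mix s y) @[y --> (x : prod_topology E)] --> A x.
  have := H (enum 'I_m); rewrite (_ : (fun y => _) = A)//; apply/funext => y.
  by congr A; apply: functional_extensionality_dep => i; rewrite /mix mem_enum.
have FF : Filter (nbhs (x : prod_topology E)) := nbhs_filter _.
have cy i : (y i : E i) @[y --> (x : prod_topology E)] --> x i.
  exact: (@proj_continuous _ E i x).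
elim: s => [|k s IH].
  rewrite (_ : (fun y => A (mix [::] y)) = cst (A x)); last first.
    by apply/funext => y; congr A; apply: functional_extensionality_dep => i; rewrite /mix in_nil.
  exact: cvg_cst.
have [ks|ks] := boolP (k \in s).
  rewrite (_ : mix (k :: s) = mix s)//; apply/funext => y.
  apply: functional_extensionality_dep => i; rewrite /mix inE.
  by have [->|//] := eqVneq i k; rewrite ks.
have mixE y : A (mix (k :: s) y) = A (mix s y) + A (dfwith (mix s y) (y k - x k)).
  have xk : mix s y k = x k by rewrite /mix (negbTE ks).
  have -> : mix (k :: s) y = dfwith (mix s y) (y k).
    apply: functional_extensionality_dep => i; rewrite {1}/mix inE.
    have [->|ik] := eqVneq i k; first by rewrite dfwith_in.
    by rewrite dfwith_out// eq_sym.
  have {1}-> : y k = mix s y k + (y k - x k) by rewrite xk addrC subrK.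
  by rewrite multilinearD// dfwith_id.
rewrite (_ : (fun y => A (mix (k :: s) y)) =
    (fun y => A (mix s y) + A (dfwith (mix s y) (y k - x k)))); last exact/funext.
rewrite -[X in _ --> X]addr0; apply: cvgD => //.
pose K := `|M| * \prod_(i | i != k) (`|x i| + 1).
have K0 : 0 <= K by rewrite mulr_ge0// prodr_ge0// => i _; rewrite addr_ge0.
have near1 : \forall y \near (x : prod_topology E), forall i, `|y i| <= `|x i| + 1.
  apply: (@filter_forall (prod_topology E) _ (fun i y => `|y i| <= `|x i| + 1) _ FF) => i.
  have /cvgrPdist_le/(_ 1 ltr01) := cy i.
  apply: filterS => y xy; rewrite -(subrK (x i) (y i)) addrC.
  by rewrite (le_trans (ler_normD _ _))// lerD2l distrC.
apply/cvgr0Pnorm_le => e e0.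
have eK : 0 < e / (K + 1) by rewrite divr_gt0// ltr_wpDl.
have /cvgrPdist_le/(_ _ eK) := cy k.
move=> near2; near=> y.
apply: le_trans (AM _) _; rewrite (bigD1 k)//= dfwith_in.
apply: le_trans (_ : K * `|y k - x k| <= _).
  rewrite mulrC -mulrA [K * _]mulrC ler_wpM2l//.
  rewrite (le_trans (_ : _ <= `|M| * \prod_(i | i != k) `|dfwith (mix s y) (y k - x k) i|))//.
    by rewrite mulrC ler_wpM2r ?prodr_ge0// ler_norm.
  rewrite ler_wpM2l//; apply: ler_prod => i ik; rewrite normr_ge0/=.
  rewrite dfwith_out 1?eq_sym// /mix; case: ifP => _; last by rewrite lerDl.
  by move: i {ik}; near: y.
have yk : `|y k - x k| <= e / (K + 1) by rewrite distrC; near: y.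
apply: le_trans (ler_wpM2l K0 yk) _; rewrite mulrCA ler_piMr ?(ltW e0)//.
by rewrite ler_pdivrMr ?ltr_wpDl// mul1r lerDl.
Unshelve. all: by end_near. Qed.

Lemma regular_multilinear_continuous (E : 'I_m -> banachLatticeType R)
    (F : banachLatticeType R) (A : (forall i, E i) -> F) :
  regular_multilinear A -> cts_multilinear A.
Proof.
move=> [A1 [A2 [p1 p2 AE]]].
have [M1 M10 A1M] := positive_multilinear_bounded p1.
have [M2 M20 A2M] := positive_multilinear_bounded p2.
apply: (@bounded_multilinear_continuous _ _ _ (M1 + M2)) => [i x a s t|x].
  by rewrite !AE p1.1 p2.1 scalerBr opprD addrACA.
by rewrite AE (le_trans (ler_normB _ _))// mulrDl lerD.
Qed.

Lemma positive_multilinear_regular (E : 'I_m -> banachLatticeType R)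
    (F : banachLatticeType R) (A : (forall i, E i) -> F) :
  positive_multilinear A -> regular_multilinear A.
Proof.
move=> pA; exists A, (fun=> 0); split=> // [|x]; last by rewrite subr0.
by split=> [i x a s t|x _]; [rewrite scaler0 addr0|exact: vle_refl].
Qed.

End MultilinearBounds.

(** * Aron-Berner extensions *)

Section AronBernerBounds.
Variables (R : realType) (m : nat).

Lemma prod_enum_perm (rho : 'S_m) (f : 'I_m -> R) :
  \prod_(k <- enum 'I_m) f (rho k) = \prod_i f i.
Proof. by rewrite big_enum [RHS](reindex_inj (@perm_inj _ rho)). Qed.

Lemma aron_berner_le (E : 'I_m -> normedModType R) (F : normedModType R)
    (A : (forall i, E i) -> F) rho : cts_multilinear A ->
  exists2 M, 0 <= M & forall x2, `|aron_berner rho A x2| <= M * \prod_i `|x2 i|.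
Proof.
move=> cA; have [M [M0 yA]] := form_on_comp cA; exists M => // x2.
apply: dual_norm_ub => [|y]; first by rewrite mulr_ge0// prodr_ge0.
have h : {in enum 'I_m, forall k, rho k \in [set: 'I_m]%SET} by move=> k _; rewrite inE.
rewrite aron_bernerE//.
have [_ _ _] := form_on_iter (rho := rho) x2 (enum_uniq 'I_m) h (yA y).
move/(_ (fun=> 0)); rewrite [X in _ <= _ * X]big1 ?mulr1; last first.
  move=> i; rewrite !inE andbT => /negP[]; apply/imsetP.
  by exists (rho^-1 i)%g; rewrite ?mem_enum// permKV.
by rewrite (prod_enum_perm rho (fun i => `|x2 i|)) mulrAC.
Qed.

Variables (E : 'I_m -> banachLatticeType R) (phi : forall i, dual (E i)).
Variables (rho : 'S_m) (x2 : forall i, dual (dual (E i))).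
Hypotheses (x20 : forall i, 0 <=v x2 i).

Lemma ab_iter_ge (s : seq 'I_m) M c (B : (forall j, E j) -> R) : uniq s ->
  form_on [set rho k | k in s]%SET M B ->
  (forall x, (forall i, 0 <=v x i) ->
    c * \prod_(k <- s) phi (rho k) (x (rho k)) <= B x) ->
  forall x, (forall i, 0 <=v x i) ->
    c * \prod_(k <- s) x2 (rho k) (phi (rho k)) <=
      foldl (fun B' k => ab_step (x2 (rho k)) B') B s x.
Proof.
elim: s M c B => [|k s IH] M c B /=.
  by move=> _ _ cB x x0; have := cB x x0; rewrite !big_nil.
move=> /andP[ks us] FB cB x x0.
have kS : rho k \in [set rho k' | k' in k :: s]%SET by rewrite imset_f// mem_head.
have SE : ([set rho k' | k' in k :: s] :\ rho k)%SET = [set rho k' | k' in s]%SET.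
  apply/setP => i; rewrite !inE; apply/andP/imsetP.
    move=> [ik /imsetP[l]]; rewrite inE => /predU1P[->|ls] il.
      by rewrite il eqxx in ik.
    by exists l.
  move=> [l ls ->]; split; last by rewrite imset_f// inE ls orbT.
  by rewrite (inj_eq perm_inj); apply: contraNneq ks => <-.
have FB' := form_on_step (x2 (rho k)) FB kS; rewrite SE in FB'.
rewrite big_cons mulrA; apply: (IH _ _ _ us FB') => // z z0.
rewrite (ab_stepE _ _ FB kS) mulrAC.
set P := c * _; rewrite -[P * _]/(P *: _) -[P *: _]linearZ; apply: dual_le => // t t0.
rewrite dualZE /=; apply: le_trans (cB _ (dfwith_ge0 z0 t0)).
rewrite big_cons dfwith_in mulrCA [X in _ <= X]mulrC /P.
suff -> : \prod_(l <- s) phi (rho l) (dfwith z t (rho l)) = \prod_(l <- s) phi (rho l) (z (rho l)) by [].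
apply: eq_big_seq => l ls; rewrite dfwith_out// (inj_eq perm_inj).
by apply: contraNneq ks => ->.
Qed.

End AronBernerBounds.

(** * The diagonal operator and lower bounds for its extensions *)

Section NoAlmostDPExtension.
Variables (R : realType) (m : nat) (E : 'I_m -> banachLatticeType R).
Variables (F : banachLatticeType R) (S : linf R -> F) (y : nat -> F).
Variables (v : forall i, nat -> dual (E i)).
Hypotheses (lS : linear S) (yS : forall a : linf R, (forall n, 0 <= a n) -> forall n, a n *: y n <=v S a).
Hypotheses (y0 : forall n, 0 <=v y n).
Hypotheses (v0 : forall i n, 0 <=v v i n) (v1 : forall i n, `|v i n| <= 1).

Fact linf_product_subproof (x : forall i, E i) :
  (fun n => \prod_i v i n (x i)) \in @linf_pred R.
Proof.
apply/asboolP; exists (\prod_i `|x i|) => n; rewrite normr_prod.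
apply: ler_prod => i _; rewrite normr_ge0/= (le_trans (dual_ler _ _))//.
by rewrite ler_piMl.
Qed.

Definition linf_product x : linf R := Linf (linf_product_subproof x).

Lemma positive_multilinear_product : positive_multilinear (S \o linf_product).
Proof.
split=> [i x c s t|x x0] /=; last first.
  have a0 n : 0 <= linf_product x n.
    by apply: prodr_ge0 => i _; apply: dual_ge0.
  apply: vle_trans (yS a0 0); exact: vle_scale_ge0.
rewrite -lS; congr S; apply/val_inj/funext => n.
rewrite -[LHS]/(\prod_j v j n (dfwith x (c *: s + t) j)).
rewrite -[RHS]/(c * \prod_j v j n (dfwith x s j) + \prod_j v j n (dfwith x t j)).
have e r : \prod_j v j n (dfwith x r j) = v i n r * \prod_(j | j != i) v j n (x j).
  rewrite (bigD1 i)//= dfwith_in; congr (_ * _).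
  by apply: eq_bigr => j ji; rewrite dfwith_out// eq_sym.
by rewrite !e linearP/= mulrDl mulrA.
Qed.

(** Test the extension on a positive [g] norming [y n]: composed with the operator, [g] dominates
    [|y n|] times the n-th product of functionals on the positive cone. *)
Lemma product_aron_berner_ge rho (w : forall i, dual (dual (E i))) n :
  (forall i, 0 <=v w i) ->
  `|y n| * \prod_i w i (v i n) <= `|aron_berner rho (S \o linf_product) w|.
Proof.
move=> w0; have cA := regular_multilinear_continuous
  (positive_multilinear_regular positive_multilinear_product).
have [g [g0 g1 gy]] := positive_norming (y n).
apply: le_trans (_ : aron_berner rho (S \o linf_product) w g <= _); last first.
  apply: le_trans (ler_norm _) _; apply: le_trans (dual_ler _ _) _.
  by rewrite ler_piMr.
rewrite aron_bernerE//; have [M [M0 FA]] := form_on_comp cA.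
have SE : [set rho k | k in enum 'I_m]%SET = [set: 'I_m]%SET.
  apply/setP => i; rewrite inE; apply/imsetP.
  by exists (rho^-1 i)%g; rewrite ?mem_enum// permKV.
have FB := FA g; rewrite -SE in FB.
rewrite -(prod_enum_perm rho (fun i => w i (v i n))).
apply: (ab_iter_ge (phi := fun i => v i n) w0 (enum_uniq 'I_m) FB) => [x x0|i] /=; last exact: vle_refl.
rewrite (prod_enum_perm rho (fun i => v i n (x i))).
have a0 k : 0 <= linf_product x k by apply: prodr_ge0 => i _; apply: dual_ge0.
rewrite -gy vabs_pos// mulrC -[_ * _]/(_ *: g (y n)) -linearZ.
by apply: dual_le => //; exact: (yS a0 n).
Qed.

End NoAlmostDPExtension.

(** * Closing the cycle of implications *)

Theorem theorem3p3 (R : realType) (m : nat) (m_gt0 : (0 < m)%N)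
    (E : 'I_m -> banachLatticeType R) (F : banachLatticeType R)
    (F_sigma : sigma_Dedekind_complete F)
    (F_linf : contains_copy (linf R) F) :
  [<-> (* (a) *)
       forall A : (forall i, E i) -> F,
         cts_multilinear A -> has_almost_DP_AB A;
       (* (b) *)
       forall A : (forall i, E i) -> F,
         regular_multilinear A -> has_almost_DP_AB A;
       (* (c) *)
       forall A : (forall i, E i) -> F,
         positive_multilinear A -> has_almost_DP_AB A;
       (* (d) *)
       exists j : 'I_m, positive_Schur (dual (dual (E j)))].
Proof.
split; [|split; [|split]].
- by move=> H A /regular_multilinear_continuous; exact: H.
- by move=> H A /positive_multilinear_regular; exact: H.
- move=> H; apply: contrapT => /forallNP nS.
  have [y [b [d [d0 y0 yd yb]]]] := contains_linf_separated_series F_linf.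
  have [S [lS yS]] := order_sum_exists F_sigma y0 yb.
  (* Witnesses are chosen in every coordinate at once, so that a common index [n] yields the lower
     bound [d * \prod_i e i]. *)
  pose wit i := cid (not_positive_Schur_dual (nS i)).
  pose w i := projT1 (wit i).
  pose wit2 i := cid (projT2 (wit i)); pose v i := projT1 (wit2 i).
  pose wit3 i := cid (projT2 (wit2 i)); pose e i := projT1 (wit3 i).
  have wP i : [/\ 0 < e i, forall n, 0 <=v w i n, disjoint_seq (w i), weakly_null (w i) &
      forall n, [/\ 0 <=v v i n, `|v i n| <= 1 & e i <= w i n (v i n)]].
    exact: projT2 (wit3 i).
  have v0 i n : 0 <=v v i n by have [_ _ _ _ /(_ n)[]] := wP i.
  have v1 i n : `|v i n| <= 1 by have [_ _ _ _ /(_ n)[]] := wP i.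
  have [rho ABn] := H _ (positive_multilinear_product lS yS y0 v0 v1).
  have {ABn}ABw : aron_berner rho (S \o linf_product v1) (w^~ n) @[n --> \oo] --> 0.
    by apply: ABn => i; have [] := wP i.
  pose c := d * \prod_i e i.
  have c0 : 0 < c.
    by rewrite mulr_gt0// prodr_gt0// => i _; have [] := wP i.
  have /cvgr0_norm_lt/(_ c c0)[N _ /(_ N (leqnn N))/=] := ABw.
  apply/negP; rewrite -leNgt.
  apply: le_trans (product_aron_berner_ge lS yS y0 v0 v1 rho N _); last first.
    by move=> i; have [_ w0 _ _ _] := wP i; exact: w0.
  apply: ler_pM; [exact: ltW| |exact: yd|].
    by apply: prodr_ge0 => i _; have [/ltW] := wP i.
  apply: ler_prod => i _; have [/ltW -> _ _ _ /(_ N)[_ _]] := wP i.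
  exact.
(* The norm bound holds for every permutation, so the identity serves. *)
- move=> [j sj] A cA; exists 1%g => x xP.
  have [M M0 AM] := aron_berner_le 1%g cA.
  have bd i := weakly_null_bounded (xP i).2.
  pose K i := projT1 (cid (bd i)).
  have KP i n : `|x i n| <= K i := projT2 (cid (bd i)) n.
  have K0 i : 0 <= K i := le_trans (normr_ge0 _) (KP i 0).
  pose C := M * \prod_(i | i != j) K i.
  have C0 : 0 <= C by rewrite mulr_ge0// prodr_ge0.
  have xj := positive_Schur_disjoint sj (xP j).1 (xP j).2.
  apply/cvgr0Pnorm_le => e e0.
  have eC : 0 < e / (C + 1) by rewrite divr_gt0// ltr_wpDl.
  have /cvgr0Pnorm_le/(_ _ eC) := xj; apply: filterS => n xn.
  apply: le_trans (AM _) _; rewrite (bigD1 j)//=.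
  apply: le_trans (_ : C * `|x j n| <= _).
    rewrite mulrCA [C * _]mulrC ler_wpM2l// ler_wpM2l//.
    by apply: ler_prod => i _; rewrite normr_ge0/=; exact: KP.
  apply: le_trans (ler_wpM2l C0 xn) _; rewrite mulrCA ler_piMr ?(ltW e0)//.
  by rewrite ler_pdivrMr ?ltr_wpDl// mul1r lerDl.
Qed.
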